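(* Work in Aczel's constructive set theory $\mathbf{CZF}$ extended with the axioms $\mathbf{(WS)}$ and $\mathbf{(AMC)}$. Let $S$ be a set and let $\Phi \subseteq \mathrm{Pow}(S) \times S$ be an inductive definition on $S$. Then: (1) for every subset (set) $U \subseteq S$, the class $I(\Phi, U)$ is a set; (2) there is a set $B$ of subsets of $S$ such that for every subclass $U \subseteq S$ and every $a \in I(\Phi, U)$ there is $V \in B$ with $V \subseteq U$ and $a \in I(\Phi, V)$. (That is, $\mathbf{CZF} + \mathbf{(WS)} + \mathbf{(AMC)}$ proves the Set Compactness Theorem.)
   Context: $\mathrm{Pow}(X)$ denotes the class of subsets of $X$. An inductive definition on a set $S$ is a subset $\Phi \subseteq \mathrm{Pow}(S)\times S$. A subclass $A \subseteq S$ is $\Phi$-closed if for every $(X,a)\in\Phi$, $X\subseteq A$ implies $a\in A$. For a subclass $U\subseteq S$, $I(\Phi,U)$ denotes the least $\Phi$-closed subclass of $S$ containing $U$ (which exists in $\mathbf{CZF}$). $\mathbf{(WS)}$: for every function $f: B\to A$ between sets, the associated W-type $W(f)$ (the well-founded trees whose nodes are labelled by $a\in A$ with branching indexed by $f^{-1}(a)$) is a set. $\mathbf{(AMC)}$: for every set $X$ there is a set $\{p_i : Y_i \twoheadrightarrow X \,:\, i\in I\}$ of surjections onto $X$ such that for every surjection $p: Y\twoheadrightarrow X$ there are $i\in I$ and a function $f: Y_i\to Y$ with $p\circ f = p_i$. *)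

(* Defs.v *)
From Stdlib Require Import List.
Import ListNotations.

(** Variables are de Bruijn indices and are the only terms. *)

Inductive fm : Type :=
| Bot : fm
| Mem : nat -> nat -> fm
| Eq  : nat -> nat -> fm
| And : fm -> fm -> fm
| Or  : fm -> fm -> fm
| Imp : fm -> fm -> fm
| All : fm -> fm
| Ex  : fm -> fm.

Declare Scope fm_scope.
Delimit Scope fm_scope with fm.
Bind Scope fm_scope with fm.
Notation "x ∈ y" := (Mem x y) (at level 35, no associativity) : fm_scope.
Notation "x == y" := (Eq x y) (at level 35, no associativity) : fm_scope.
Notation "A && B" := (And A B) (at level 40, left associativity) : fm_scope.
Notation "A || B" := (Or A B) (at level 50, left associativity) : fm_scope.
Notation "A --> B" := (Imp A B) (at level 55, right associativity) : fm_scope.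
Notation "A <--> B" := (And (Imp A B) (Imp B A))
  (at level 56, no associativity) : fm_scope.
Open Scope fm_scope.

Definition up (f : nat -> nat) (n : nat) : nat :=
  match n with 0 => 0 | S m => S (f m) end.

Fixpoint ren (f : nat -> nat) (A : fm) : fm :=
  match A with
  | Bot => Bot
  | Mem x y => Mem (f x) (f y)
  | Eq x y => Eq (f x) (f y)
  | And A B => And (ren f A) (ren f B)
  | Or A B => Or (ren f A) (ren f B)
  | Imp A B => Imp (ren f A) (ren f B)
  | All A => All (ren (up f) A)
  | Ex A => Ex (ren (up f) A)
  end.

Definition shift : fm -> fm := ren S.

(** [inst t A] is A with variable 0 replaced by the outer variable t. *)
Definition inst (t : nat) : fm -> fm :=
  ren (fun n => match n with 0 => t | S m => m end).

Fixpoint upn (n : nat) (f : nat -> nat) : nat -> nat :=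
  match n with 0 => f | S m => up (upn m f) end.

(** [lift n k A] keeps the variables 0, ..., n-1 of A and moves the others
    past k further binders. *)
Definition lift (n k : nat) : fm -> fm := ren (upn n (Nat.add k)).

(** Natural deduction from the axioms T; free variables of an axiom are
    implicitly universally quantified (rule [AllI] does not shift T). *)
Inductive prv (T : fm -> Prop) (G : list fm) : fm -> Prop :=
| Ax A : T A -> prv T G A
| Hyp A : In A G -> prv T G A
| BotE A : prv T G Bot -> prv T G A
| AndI A B : prv T G A -> prv T G B -> prv T G (A && B)
| AndE1 A B : prv T G (A && B) -> prv T G A
| AndE2 A B : prv T G (A && B) -> prv T G B
| OrI1 A B : prv T G A -> prv T G (A || B)
| OrI2 A B : prv T G B -> prv T G (A || B)
| OrE A B C : prv T G (A || B) -> prv T (A :: G) C -> prv T (B :: G) C ->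
    prv T G C
| ImpI A B : prv T (A :: G) B -> prv T G (A --> B)
| ImpE A B : prv T G (A --> B) -> prv T G A -> prv T G B
| AllI A : prv T (map shift G) A -> prv T G (All A)
| AllE A t : prv T G (All A) -> prv T G (inst t A)
| ExI A t : prv T G (inst t A) -> prv T G (Ex A)
| ExE A B : prv T G (Ex A) -> prv T (A :: map shift G) (shift B) -> prv T G B
| EqRefl x : prv T G (x == x)
| EqSubst A x y : prv T G (x == y) -> prv T G (inst x A) -> prv T G (inst y A).

(** Below, arguments of type nat (x, y, f, a, ...) are variables of the ambient
    context; they are incremented under binders. *)

Definition BAll (a : nat) (A : fm) : fm := All (0 ∈ S a --> A).
Definition BEx (a : nat) (A : fm) : fm := Ex (0 ∈ S a && A).

Inductive bounded : fm -> Prop :=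
| bd_Bot : bounded Bot
| bd_Mem x y : bounded (x ∈ y)
| bd_Eq x y : bounded (x == y)
| bd_And A B : bounded A -> bounded B -> bounded (A && B)
| bd_Or A B : bounded A -> bounded B -> bounded (A || B)
| bd_Imp A B : bounded A -> bounded B -> bounded (A --> B)
| bd_All a A : bounded A -> bounded (BAll a A)
| bd_Ex a A : bounded A -> bounded (BEx a A).

Definition Sub (x y : nat) : fm := BAll x (0 ∈ S y).
Definition Empty (x : nat) : fm := BAll x Bot.
(** x = y ∪ {y} *)
Definition Succ (x y : nat) : fm :=
  All (0 ∈ S x <--> 0 ∈ S y || 0 == S y).
(** z = {x, y} *)
Definition UPair (z x y : nat) : fm :=
  All (0 ∈ S z <--> 0 == S x || 0 == S y).
(** z = (x, y) = {{x}, {x, y}} *)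
Definition OPair (z x y : nat) : fm :=
  All (0 ∈ S z <--> UPair 0 (S x) (S x) || UPair 0 (S x) (S y)).
(** (x, y) ∈ r *)
Definition PairIn (x y r : nat) : fm := BEx r (OPair 0 (S x) (S y)).

(** f : a → b, as a graph f ⊆ a × b *)
Definition Fun (f a b : nat) : fm :=
  BAll f (BEx (S a) (BEx (2 + b) (OPair 2 1 0))) &&
  BAll a (Ex (PairIn 1 0 (2 + f))) &&
  All (All (All (PairIn 2 1 (3 + f) --> PairIn 2 0 (3 + f) --> 1 == 0))).

Definition Surj (f a b : nat) : fm :=
  Fun f a b && BAll b (BEx (S a) (PairIn 0 1 (2 + f))).

(** For a relation R(x, y), with y variable 0 and x variable 1:
    ∀x∈a ∃y∈b R(x, y) and ∀y∈b ∃x∈a R(x, y). *)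
Definition swap (n : nat) : nat :=
  match n with 0 => 1 | 1 => 0 | _ => n end.
Definition TotalBoth (a b : nat) (R : fm) : fm :=
  BAll a (BEx (S b) R) && BAll b (BEx (S a) (ren swap R)).

(* a = 1, b = 0 *)
Definition Extensionality : fm :=
  All (All (All (0 ∈ 2 <--> 0 ∈ 1) --> 1 == 0)).

Definition Pairing : fm := All (All (Ex (UPair 0 2 1))).

(* a = 2, b = 1, x = 0 *)
Definition Union : fm := All (Ex (All (0 ∈ 1 <--> BEx 2 (1 ∈ 0)))).

(* w = 1, x = 0 *)
Definition Infinity : fm :=
  Ex (All (0 ∈ 1 <--> Empty 0 || BEx 1 (Succ 1 0))).

(** A(x), x = 0: (∀a ((∀x∈a A(x)) → A(a))) → ∀a A(a) *)
Definition SetInduction (A : fm) : fm :=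
  All (BAll 0 (lift 1 1 A) --> A) --> All A.

(** A(x), x = 0: ∀a ∃b ∀x (x ∈ b ↔ x ∈ a ∧ A(x)) *)
Definition Separation (A : fm) : fm :=
  All (Ex (All (0 ∈ 1 <--> 0 ∈ 2 && lift 1 2 A))).

(** R(x, y), y = 0, x = 1:
    ∀a (∀x∈a ∃y R → ∃b (∀x∈a ∃y∈b R ∧ ∀y∈b ∃x∈a R)) *)
Definition StrongCollection (R : fm) : fm :=
  All (BAll 0 (Ex (lift 2 1 R)) --> Ex (TotalBoth 1 0 (lift 2 2 R))).

(** R(x, y, u), y = 0, x = 1, u = 2:
    ∀a ∀b ∃c ∀u (∀x∈a ∃y∈b R → ∃d∈c (∀x∈a ∃y∈d R ∧ ∀y∈d ∃x∈a R)) *)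
Definition SubsetCollection (R : fm) : fm :=
  All (All (Ex (All (
    BAll 3 (BEx 3 (lift 3 3 R)) -->
    BEx 1 (TotalBoth 4 0 (lift 2 1 (lift 3 3 R))))))).

Inductive CZF : fm -> Prop :=
| CZF_extensionality : CZF Extensionality
| CZF_pairing : CZF Pairing
| CZF_union : CZF Union
| CZF_infinity : CZF Infinity
| CZF_set_induction A : CZF (SetInduction A)
| CZF_separation A : bounded A -> CZF (Separation A)
| CZF_strong_collection R : CZF (StrongCollection R)
| CZF_subset_collection R : CZF (SubsetCollection R).

(** d = f⁻¹(a), for a function f *)
Definition Fiber (d f a : nat) : fm :=
  All (0 ∈ S d <--> PairIn 0 (S a) (S f)).

(** x = (a, t) for some a ∈ A and t : f⁻¹(a) → T: the tree x has label a at
    its root and immediate subtrees in T, indexed by f⁻¹(a).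
    Bound variables: a = 2, d = f⁻¹(a) = 1, t = 0. *)
Definition Node (x f A T : nat) : fm :=
  BEx A (Ex (Ex (
    OPair (3 + x) 2 0 && Fiber 1 (3 + f) 2 && Fun 0 1 (3 + T)))).

(** x ∈ W(f), for f : B → A: x lies in a set T all of whose elements are nodes
    with subtrees in T. Such trees are well-founded by Set Induction, a subtree
    of x being in the transitive closure of x. *)
Definition WTree (x f A : nat) : fm :=
  Ex (S x ∈ 0 && BAll 0 (Node 0 (2 + f) (2 + A) 1)).

(* f = 2, B = 1, A = 0; then W = 1, x = 0 *)
Definition WS : fm :=
  All (All (All (Fun 2 1 0 --> Ex (All (0 ∈ 1 <--> WTree 0 4 2))))).

(** p ∘ f = q, for functions q : Z → X, f : Z → Y and p : Y → X *)
Definition Factors (p f q : nat) : fm :=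
  All (All (All (
    PairIn 2 1 (3 + f) --> PairIn 1 0 (3 + p) --> PairIn 2 0 (3 + q)))).

(** ∀X ∃P ((∀q∈P ∃Z q : Z ↠ X) ∧ ∀Y ∀p (p : Y ↠ X →
      ∃q∈P ∃Z ∃f (q : Z ↠ X ∧ f : Z → Y ∧ p ∘ f = q))) *)
Definition AMC : fm :=
  All (Ex (
    BAll 0 (Ex (Surj 1 0 3)) &&
    All (All (Surj 0 1 3 -->
      BEx 2 (Ex (Ex (Surj 2 1 6 && Fun 0 1 4 && Factors 3 0 2))))))).

Inductive CZF_WS_AMC : fm -> Prop :=
| of_CZF A : CZF A -> CZF_WS_AMC A
| of_WS : CZF_WS_AMC WS
| of_AMC : CZF_WS_AMC AMC.

(** A class is a formula C, standing for {x | C(x)} with x variable 0; its other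
    variables are set parameters, variable m+1 of C being variable m of the
    ambient context. *)

Definition SetCls (u : nat) : fm := 0 ∈ S u.
Definition SubCls (C D : fm) : fm := All (C --> D).
Definition IsSet (C : fm) : fm := Ex (All (0 ∈ 1 <--> lift 1 1 C)).

(** Φ ⊆ Pow(S) × S, where s and p are the variables for S and Φ *)
Definition IndDef (s p : nat) : fm :=
  BAll p (Ex (Ex (OPair 2 1 0 && Sub 1 (3 + s) && 0 ∈ (3 + s)))).

(** ∀X ∀a ((X, a) ∈ Φ → X ⊆ C → a ∈ C) *)
Definition Closed (p : nat) (C : fm) : fm :=
  All (All (PairIn 1 0 (2 + p) --> BAll 1 (lift 1 2 C) --> lift 1 1 C)).

(** C is a Φ-closed subclass of S containing U. *)
Definition ClosedOver (s p : nat) (U C : fm) : fm :=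
  SubCls C (SetCls s) && Closed p C && SubCls U C.

(** T proves that, whenever Φ is an inductive definition on S and U ⊆ S, the
    class J is the least Φ-closed subclass of S containing U. As usual in CZF,
    the quantification over all classes C is a schema. *)
Definition IsLeastClosed (T : fm -> Prop) (s p : nat) (U J : fm) : Prop :=
  let H := [IndDef s p; SubCls U (SetCls s)] in
  prv T H (ClosedOver s p U J) /\
  (forall C : fm, prv T H (ClosedOver s p U C --> SubCls J C)).

(* Main.v *)
Require Import Defs.
From Stdlib Require Import List Lia Arith.
Import ListNotations.

(** I(Φ,U) is the union of all sets t of pairs (s, a) in which every a is either in U
    or the conclusion of a rule whose premises occur in t at elements of s; Strong
    Collection makes it closed, and induction on s makes it least. For compactness,
    AMC and Strong Collection give a set Q of surjections such that, for every rule
    (X, a), each surjection onto X is refined by one in Q. Trees with inner nodes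
    labelled by Q and leaves labelled by S form a set W. Each w ∈ W has a set V of
    leaves and a set C ⊆ I(Φ,V), computed along the tree, such that whenever w is a
    derivation of a from U then V ⊆ U and a ∈ C. By AMC every a ∈ I(Φ,U) has a
    derivation in W: derivations of the premises form a set Y with a surjection
    Y → X, and a refinement of it in Q chooses one premise derivation per branch.
    Hence the pairs (V, C) for w ∈ W determine I(Φ,U) for all U. *)

(** * Renaming *)

(** The obstacle is that being a derivation is not a bounded condition, so Separation cannot select
    the derivations among the trees. Nothing is therefore decided about a tree. An inner node names
    only a member of Q, neither a rule nor U, so one set W serves all U, and a tree may derive
    several conclusions. Its set C overapproximates them: it takes every a ∈ S with a rule (X, a)
    whose premises X lie in the sets C of the subtrees. This definition is bounded, and C ⊆ I(Φ,V)
    holds whether or not the tree is a derivation of anything. *)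

Definition scons (x : nat) (f : nat -> nat) (n : nat) : nat :=
  match n with 0 => x | S m => f m end.
Local Notation "x .: f" := (scons x f) (at level 55, right associativity).
Local Notation idn := (fun n : nat => n).

(** Convertible to [inst x C], but left folded by the simplification tactics below. *)
Definition at1 (C : fm) (x : nat) : fm := ren (x .: idn) C.

Lemma ren_ext A : forall f g, (forall n, f n = g n) -> ren f A = ren g A.
Proof.
  induction A; intros f g H; cbn; f_equal; auto;
    match goal with IH : forall f g, _ -> ren f ?A = ren g ?A |- _ => apply IH end;
    intros [|n]; cbn; auto.
Qed.

Lemma ren_ren A : forall f g, ren f (ren g A) = ren (fun n => f (g n)) A.
Proof.
  induction A; intros f g; cbn; f_equal; auto;
    rewrite IHA; apply ren_ext; intros [|n]; reflexivity.
Qed.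

Lemma ren_id A : forall f, (forall n, f n = n) -> ren f A = A.
Proof.
  induction A; intros f H; cbn; f_equal; auto;
    apply IHA; intros [|n]; cbn; auto.
Qed.

Fixpoint fv_bound (A : fm) : nat :=
  match A with
  | Bot => 0
  | Mem x y | Eq x y => S (max x y)
  | And A B | Or A B | Imp A B => max (fv_bound A) (fv_bound B)
  | All A | Ex A => pred (fv_bound A)
  end.

Lemma ren_ext_bound A : forall f g,
  (forall n, n < fv_bound A -> f n = g n) -> ren f A = ren g A.
Proof.
  induction A; cbn; intros f g H;
    try (f_equal; first [apply H; lia | apply IHA1 | apply IHA2 | idtac];
         intros; apply H; lia);
    try reflexivity.
  all: f_equal; apply IHA; intros [|n] Hn; cbn; auto; f_equal; apply H; lia.
Qed.

(** The renamings compared differ only in finitely many variables and in constant shifts: past the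
    eighth variable both sides reduce to the same term in n. *)
Ltac ren_solve :=
  unfold at1, shift, lift, inst; repeat rewrite ren_ren;
  first [apply ren_ext | apply ren_id | symmetry; apply ren_id];
  let n := fresh "n" in intros n;
  do 8 (try (destruct n as [|n]; [reflexivity|])); reflexivity.

Lemma ren_inst f t A : ren f (inst t A) = inst (f t) (ren (up f) A).
Proof. ren_solve. Qed.
Lemma ren_shift f A : ren (up f) (shift A) = shift (ren f A).
Proof. ren_solve. Qed.
(** These equations, up to [ren_swap], make a renamed axiom instance the instance of the same scheme
    at the renamed formula. *)
Lemma ren_lift11 f A : ren (up (up f)) (lift 1 1 A) = lift 1 1 (ren (up f) A).
Proof. ren_solve. Qed.
Lemma ren_lift12 f A :
  ren (up (up (up f))) (lift 1 2 A) = lift 1 2 (ren (up f) A).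
Proof. ren_solve. Qed.
Lemma ren_lift21 f A :
  ren (up (up (up f))) (lift 2 1 A) = lift 2 1 (ren (up (up f)) A).
Proof. ren_solve. Qed.
Lemma ren_lift22 f A :
  ren (up (up (up (up f)))) (lift 2 2 A) = lift 2 2 (ren (up (up f)) A).
Proof. ren_solve. Qed.
Lemma ren_lift33 f A :
  ren (up (up (up (up (up (up f)))))) (lift 3 3 A) =
  lift 3 3 (ren (up (up (up f))) A).
Proof. ren_solve. Qed.
Lemma ren_swap f A : ren (up (up f)) (ren swap A) = ren swap (ren (up (up f)) A).
Proof. ren_solve. Qed.

Lemma bounded_ren A : bounded A -> forall f, bounded (ren f A).
Proof.
  induction 1; intros f; cbn; try (constructor; auto; fail).
Qed.

(** * Natural deduction *)

Lemma prv_weak T G G' A : incl G G' -> prv T G A -> prv T G' A.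
Proof.
  intros Hi H; revert G' Hi; induction H; intros G' Hi;
    try (econstructor; eauto; fail).
  - eapply OrE; [apply IHprv1 | apply IHprv2 | apply IHprv3]; auto;
      intros x [|]; cbn; auto.
  - apply ImpI, IHprv. intros x [|]; cbn; auto.
  - apply AllI, IHprv. apply incl_map, Hi.
  - eapply ExE; [apply IHprv1, Hi|apply IHprv2].
    intros x [|]; cbn; auto. right. revert H1. apply incl_map, Hi.
Qed.

Class Theory (T : fm -> Prop) : Prop := {
  czf_in : forall A, CZF A -> T A;
  ren_in : forall f A, T A -> T (ren f A)
}.

#[local] Instance CZF_theory : Theory CZF.
Proof.
  split; [auto|]. intros f A [| | | |A'|A' H|R|R]; try (constructor; fail).
  - replace (ren f (SetInduction A')) with (SetInduction (ren (up f) A'))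
      by (unfold SetInduction, BAll; cbn; now rewrite ren_lift11).
    constructor.
  - replace (ren f (Separation A')) with (Separation (ren (up f) A'))
      by (unfold Separation; cbn; now rewrite ren_lift12).
    constructor. now apply bounded_ren.
  - replace (ren f (StrongCollection R))
      with (StrongCollection (ren (up (up f)) R))
      by (unfold StrongCollection, TotalBoth, BAll, BEx; cbn;
          now rewrite ren_lift21, ren_swap, ren_lift22).
    constructor.
  - replace (ren f (SubsetCollection R))
      with (SubsetCollection (ren (up (up (up f))) R))
      by (unfold SubsetCollection, TotalBoth, BAll, BEx; cbn;
          repeat first [rewrite ren_lift33 | rewrite ren_swap | rewrite ren_lift21];
          reflexivity).
    constructor.
Qed.

#[local] Instance CZF_WS_AMC_theory : Theory CZF_WS_AMC.
Proof.
  split; [exact of_CZF|]. intros f A [A' H| |].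
  - now apply of_CZF, ren_in.
  - exact of_WS.
  - exact of_AMC.
Qed.

Lemma map_ext_bound G f g (k : nat) :
  (forall n, n < k -> f n = g n) -> (forall A, In A G -> fv_bound A <= k) ->
  map (ren f) G = map (ren g) G.
Proof.
  intros H Hk. apply map_ext_in. intros A HA. apply ren_ext_bound.
  intros n Hn. apply H. specialize (Hk A HA). lia.
Qed.

Lemma list_bound G : exists k, forall A, In A G -> fv_bound A <= k.
Proof.
  induction G as [|B G [k IH]]; [exists 0; intros A []|].
  exists (max (fv_bound B) k). intros A [<-|H]; [lia|].
  specialize (IH A H). lia.
Qed.

Section Deduction.
Context {T : fm -> Prop} {HT : Theory T}.
Local Notation "G ⊢ A" := (prv T G A) (at level 70).

Lemma prv_ren G A : G ⊢ A -> forall f, map (ren f) G ⊢ ren f A.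
Proof.
  assert (E : forall f G, map (ren (up f)) (map shift G) = map shift (map (ren f) G)).
  { intros f G0. rewrite !map_map. apply map_ext. intros. apply ren_shift. }
  induction 1; intros f; cbn in *.
  - now apply Ax, ren_in.
  - apply Hyp, in_map, H.
  - now apply BotE.
  - now apply AndI.
  - eapply AndE1; eauto.
  - eapply AndE2; eauto.
  - now apply OrI1.
  - now apply OrI2.
  - eapply OrE; eauto.
  - apply ImpI; auto.
  - eapply ImpE; eauto.
  - apply AllI. rewrite <- E. auto.
  - rewrite ren_inst. apply AllE. apply (IHprv f).
  - apply ExI with (f t). rewrite <- ren_inst. auto.
  - eapply ExE; [apply (IHprv1 f)|].
    specialize (IHprv2 (up f)). rewrite E, ren_shift in IHprv2. exact IHprv2.
  - apply EqRefl.
  - rewrite ren_inst. apply EqSubst with (f x); [apply (IHprv1 f)|].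
    rewrite <- ren_inst. auto.
Qed.

(** In the following rules eigenvariables are Coq variables and assumptions are Coq
    hypotheses over an extended context; this is sound as a theory is closed under
    renaming and a fresh variable always exists. *)

Lemma all_intro G A : (forall x, G ⊢ inst x A) -> G ⊢ All A.
Proof.
  intros H. destruct (list_bound (A :: G)) as [k Hk].
  (* Since k is fresh for A and G, sending k to 0 and every other m to [S m] turns [H k] into the
     premise of [AllI]. *)
  pose proof (prv_ren _ _ (H k) (fun m => if m =? k then 0 else S m)) as P.
  apply AllI.
  assert (EA : ren (fun m => if m =? k then 0 else S m) (inst k A) = A).
  { unfold inst. rewrite ren_ren.
    rewrite <- (ren_id A idn) at 2 by reflexivity. apply ren_ext_bound.
    intros [|m] Hm; [now rewrite Nat.eqb_refl|].
    specialize (Hk A (or_introl eq_refl)).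
    destruct (Nat.eqb_spec m k); lia. }
  rewrite EA in P.
  replace (map shift G) with (map (ren (fun m => if m =? k then 0 else S m)) G); auto.
  apply map_ext_bound with k; [|firstorder].
  intros n Hn. destruct (Nat.eqb_spec n k); lia.
Qed.

Lemma imp_intro G A B :
  (forall G', incl G G' -> G' ⊢ A -> G' ⊢ B) -> G ⊢ A --> B.
Proof.
  intros H. apply ImpI, H; [|apply Hyp; now left]. intros x Hx; now right.
Qed.

Lemma bound_intro G a A :
  (forall x G', incl G G' -> G' ⊢ x ∈ a -> G' ⊢ inst x A) -> G ⊢ BAll a A.
Proof. intros H. apply all_intro. intros x. apply imp_intro, H. Qed.

Lemma or_elim G A B C : G ⊢ A || B ->
  (forall G', incl G G' -> G' ⊢ A -> G' ⊢ C) ->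
  (forall G', incl G G' -> G' ⊢ B -> G' ⊢ C) -> G ⊢ C.
Proof.
  intros H HA HB. eapply OrE; [exact H|apply HA|apply HB];
    try (apply Hyp; now left); intros x Hx; now right.
Qed.

Lemma ex_elim G A C : G ⊢ Ex A ->
  (forall x G', incl G G' -> G' ⊢ inst x A -> G' ⊢ C) -> G ⊢ C.
Proof.
  intros H HC. eapply ExE; [exact H|].
  assert (K : G ⊢ All (A --> shift C)).
  { apply all_intro. intros x. apply imp_intro. intros G' Hi HA.
    replace (ren _ (shift C)) with C by ren_solve. eapply HC; eauto. }
  (* Renamed by [S] and instantiated at the new variable 0, K becomes the open implication from A to
     [shift C]. *)
  pose proof (prv_ren _ _ K S) as P. apply AllE with (t := 0) in P.
  replace (inst 0 _) with (A --> shift C) in P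
    by (unfold inst; cbn [ren]; f_equal; ren_solve).
  eapply ImpE; [|apply Hyp; now left].
  eapply prv_weak; [|exact P]. intros x Hx; now right.
Qed.

Lemma bex_elim G a A C : G ⊢ BEx a A ->
  (forall x G', incl G G' -> G' ⊢ x ∈ a -> G' ⊢ inst x A -> G' ⊢ C) -> G ⊢ C.
Proof.
  intros H HC. apply (ex_elim _ _ _ H). intros x G' Hi HA.
  apply (HC x G' Hi); [eapply AndE1|eapply AndE2]; exact HA.
Qed.

Lemma bex_intro G a A x : G ⊢ x ∈ a -> G ⊢ inst x A -> G ⊢ BEx a A.
Proof. intros H1 H2. apply ExI with x. now apply AndI. Qed.

Lemma bound_elim G a A x : G ⊢ BAll a A -> G ⊢ x ∈ a -> G ⊢ inst x A.
Proof.
  intros H Hx. eapply ImpE; [|exact Hx]. exact (AllE _ _ _ x H).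
Qed.

Lemma iff_mp G A B : G ⊢ A <--> B -> G ⊢ A -> G ⊢ B.
Proof. intros H. eapply ImpE, AndE1, H. Qed.
Lemma iff_mpr G A B : G ⊢ A <--> B -> G ⊢ B -> G ⊢ A.
Proof. intros H. eapply ImpE, AndE2, H. Qed.

Lemma prv_eq_sym G x y : G ⊢ x == y -> G ⊢ y == x.
Proof.
  intros H. exact (EqSubst T G (0 == S x) x y H (EqRefl _ _ _)).
Qed.

End Deduction.

(* Tactics for deductions inside the object theory *)
#[local] Hint Rewrite ren_ren : fm.

Ltac gsimp := unfold inst, lift, shift; cbn [ren up upn swap Nat.add scons].
Ltac gsimp_in H :=
  unfold inst, lift, shift in H; cbn [ren up upn swap Nat.add scons] in H.

Lemma ren_BAll f a A : ren f (BAll a A) = BAll (f a) (ren (up f) A).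
Proof. reflexivity. Qed.
Lemma ren_BEx f a A : ren f (BEx a A) = BEx (f a) (ren (up f) A).
Proof. reflexivity. Qed.

(** Rewriting with these equations keeps the defined predicates folded when a quantifier in front of
    them is instantiated. *)
Lemma ren_Sub f x y : ren f (Sub x y) = Sub (f x) (f y).
Proof. reflexivity. Qed.
Lemma ren_Empty f x : ren f (Empty x) = Empty (f x).
Proof. reflexivity. Qed.
Lemma ren_UPair f x y z : ren f (UPair x y z) = UPair (f x) (f y) (f z).
Proof. reflexivity. Qed.
Lemma ren_OPair f x y z : ren f (OPair x y z) = OPair (f x) (f y) (f z).
Proof. reflexivity. Qed.
Lemma ren_PairIn f x y z : ren f (PairIn x y z) = PairIn (f x) (f y) (f z).
Proof. reflexivity. Qed.
Lemma ren_Fun f x y z : ren f (Fun x y z) = Fun (f x) (f y) (f z).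
Proof. reflexivity. Qed.
Lemma ren_Surj f x y z : ren f (Surj x y z) = Surj (f x) (f y) (f z).
Proof. reflexivity. Qed.
Lemma ren_Fiber f x y z : ren f (Fiber x y z) = Fiber (f x) (f y) (f z).
Proof. reflexivity. Qed.
Lemma ren_Factors f x y z : ren f (Factors x y z) = Factors (f x) (f y) (f z).
Proof. reflexivity. Qed.
Lemma ren_Node f x y z t : ren f (Node x y z t) = Node (f x) (f y) (f z) (f t).
Proof. reflexivity. Qed.
Lemma ren_WTree f x y z : ren f (WTree x y z) = WTree (f x) (f y) (f z).
Proof. reflexivity. Qed.
Lemma ren_IndDef f s p : ren f (IndDef s p) = IndDef (f s) (f p).
Proof. reflexivity. Qed.

#[local] Hint Rewrite ren_BAll ren_BEx ren_Sub ren_Empty ren_UPair ren_OPair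
  ren_PairIn ren_Fun ren_Surj ren_Fiber ren_Factors ren_Node ren_WTree
  ren_IndDef : fm.

Ltac fs := gsimp; autorewrite with fm; gsimp.
Ltac fs_in H := gsimp_in H; autorewrite with fm in H; gsimp_in H.

(** Transports all hypotheses along Hs : incl G G', after which G' is called G. In the
    tactics below, fi introduces, fx, fa and fo eliminate Ex, And and Or, fal and fbl
    instantiate All and BAll, fex and fbx give witnesses for Ex and BEx; rx and ri do
    not simplify the result. *)
Ltac wk Hs :=
  repeat match goal with H : prv _ ?G _ |- _ =>
    match type of Hs with incl G _ => apply (prv_weak _ _ _ _ Hs) in H end end;
  match type of Hs with incl ?G ?G' =>
    clear Hs; try (clear G; rename G' into G) end.

Ltac fhnf :=
  lazymatch goal with |- prv ?T ?G ?A =>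
    let A' := eval hnf in A in change (prv T G A') end.
Tactic Notation "fi" ident(x) :=
  fhnf; lazymatch goal with
  | |- prv _ _ (All _) => apply all_intro; intro x; fs
  | |- prv _ _ (Imp _ _) =>
      apply imp_intro; let G := fresh "G" in let Hs := fresh "Hs" in
      intros G Hs x; wk Hs
  end.
Tactic Notation "fi" ident(x) ident(H) :=
  try unfold Sub at 1;
  apply bound_intro; let G := fresh "G" in let Hs := fresh "Hs" in
  intros x G Hs H; wk Hs; fs.

Tactic Notation "fx" hyp(H) ident(x) :=
  apply (ex_elim _ _ _ H); clear H;
  let G := fresh "G" in let Hs := fresh "Hs" in
  intros x G Hs H; wk Hs; fs_in H.
Tactic Notation "fx" hyp(H) ident(x) ident(Hx) :=
  apply (bex_elim _ _ _ _ H); clear H;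
  let G := fresh "G" in let Hs := fresh "Hs" in
  intros x G Hs Hx H; wk Hs; fs_in H.

Tactic Notation "rx" hyp(H) ident(x) :=
  apply (ex_elim _ _ _ H); clear H;
  let G := fresh "G" in let Hs := fresh "Hs" in
  intros x G Hs H; wk Hs.
Tactic Notation "rx" hyp(H) ident(x) ident(Hx) :=
  apply (bex_elim _ _ _ _ H); clear H;
  let G := fresh "G" in let Hs := fresh "Hs" in
  intros x G Hs Hx H; wk Hs.
Tactic Notation "ri" ident(x) ident(H) :=
  apply bound_intro; let G := fresh "G" in let Hs := fresh "Hs" in
  intros x G Hs H; wk Hs.

Tactic Notation "fa" hyp(H) ident(A) ident(B) :=
  let t := fresh "t" in rename H into t;
  pose proof (AndE1 _ _ _ _ t) as A; pose proof (AndE2 _ _ _ _ t) as B; clear t.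
Tactic Notation "fa" hyp(H) ident(A) ident(B) ident(C) :=
  let t := fresh "t" in fa H t C; fa t A B.
Tactic Notation "fa" hyp(H) ident(A) ident(B) ident(C) ident(D) :=
  let t := fresh "t" in fa H t D; fa t A B C.
Tactic Notation "fa" hyp(H) ident(A) ident(B) ident(C) ident(D) ident(E) :=
  let t := fresh "t" in fa H t E; fa t A B C D.

Ltac fo H :=
  apply (or_elim _ _ _ _ H); clear H;
  let G := fresh "G" in let Hs := fresh "Hs" in intros G Hs H; wk Hs.

Tactic Notation "fex" constr(x) := apply ExI with x; fs.
Tactic Notation "fbx" constr(x) := apply bex_intro with x; [|fs].
Ltac fsplit :=
  repeat lazymatch goal with |- prv _ _ (And _ _) => apply AndI end.

Tactic Notation "fal" constr(H) constr(x) "as" ident(K) :=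
  pose proof (AllE _ _ _ x H) as K; fs_in K.
Tactic Notation "fbl" constr(H) constr(x) constr(Hx) "as" ident(K) :=
  pose proof (bound_elim _ _ _ x H Hx) as K; fs_in K.

Ltac nats l :=
  match goal with
  | z : nat |- _ => lazymatch l with context [cons z _] => fail | _ => nats (cons z l) end
  | _ => l
  end.
Ltac shiftall A l :=
  lazymatch l with
  | nil => A
  | cons ?z ?l' =>
      let F := eval pattern z in A in
      lazymatch F with ?f _ => let A' := eval cbv beta in (f (S z)) in shiftall A' l' end
  end.
(** A formula B with [inst x B] convertible to A, to which EqSubst applies: the
    variables of A are shifted and x becomes 0. Defined predicates such as OPair
    commute with renaming by conversion, so B is found without unfolding them. *)
Ltac abstract_var x A :=
  let F := eval pattern x in A in
  lazymatch F with ?f _ =>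
    let A' := eval cbv beta in (f 0) in
    let l := nats (@nil nat) in shiftall A' l
  end.
Ltac replace_var x y A :=
  let F := eval pattern x in A in
  lazymatch F with ?f _ => eval cbv beta in (f y) end.

Ltac fsubst H :=
  cbn [scons] in H;
  lazymatch type of H with
  | prv ?T ?G (Eq ?x ?y) =>
      repeat match goal with
      (* A schematic C cannot be shifted by [abstract_var]; but [at1 C x] is convertible to
         [inst x C], so C itself serves in [EqSubst]. *)
      | K : prv T G (at1 ?C x) |- _ =>
          let K' := fresh in rename K into K';
          assert (K : prv T G (at1 C y)) by exact (EqSubst T G C x y H K');
          clear K'
      | K : prv T G ?A |- _ =>
          lazymatch K with H => fail | _ =>
          lazymatch A with context [x] =>
            let B := abstract_var x A in
            let A' := replace_var x y A in
            let K' := fresh in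
            rename K into K';
            assert (K : prv T G A') by exact (EqSubst T G B x y H K');
            clear K'
          end end
      end;
      try lazymatch goal with
      | |- prv T G (at1 ?C x) =>
          let K' := fresh in
          cut (prv T G (at1 C y)); [intro K'; exact (EqSubst T G C y x (prv_eq_sym _ _ _ H) K')|]
      | |- prv T G ?A =>
          lazymatch A with context [x] =>
            let B := abstract_var x A in
            let A' := replace_var x y A in
            let K' := fresh in
            cut (prv T G A'); [intro K'; exact (EqSubst T G B y x (prv_eq_sym _ _ _ H) K')|]
          end
      end;
      clear H; try clear x
  end.

(** * Bounded formulas, axioms as rules, and pairs *)

Section Sets.
Context {T : fm -> Prop} {HT : Theory T}.
Local Notation "G ⊢ A" := (prv T G A) (at level 70).

Lemma all_iff1 G A B x : G ⊢ All (A <--> B) -> G ⊢ inst x A -> G ⊢ inst x B.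
Proof. intros H. apply iff_mp. exact (AllE _ _ _ x H). Qed.
Lemma all_iff2 G A B x : G ⊢ All (A <--> B) -> G ⊢ inst x B -> G ⊢ inst x A.
Proof. intros H. apply iff_mpr. exact (AllE _ _ _ x H). Qed.

Lemma iff_intro G A B :
  (forall G', incl G G' -> G' ⊢ A -> G' ⊢ B) ->
  (forall G', incl G G' -> G' ⊢ B -> G' ⊢ A) -> G ⊢ A <--> B.
Proof. intros H1 H2. apply AndI; apply imp_intro; assumption. Qed.

(** ** Formulas equivalent to bounded ones *)

Definition delta0 (A : fm) : Prop :=
  exists B, bounded B /\ forall G, G ⊢ A <--> B.

Lemma delta0_of A B : delta0 B -> (forall G, G ⊢ A <--> B) -> delta0 A.
Proof.
  intros (C & HC & K) H. exists C. split; [exact HC|]. intros G.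
  apply iff_intro; intros G' Hs HA.
  - eapply iff_mp; [apply K|]. eapply iff_mp; [apply H|exact HA].
  - eapply iff_mpr; [apply H|]. eapply iff_mpr; [apply K|exact HA].
Qed.

Lemma delta0_Bot : delta0 Bot.
Proof. exists Bot. split; [constructor|]. intros; apply iff_intro; auto. Qed.
Lemma delta0_Mem x y : delta0 (x ∈ y).
Proof. exists (x ∈ y). split; [constructor|]. intros; apply iff_intro; auto. Qed.
Lemma delta0_Eq x y : delta0 (x == y).
Proof. exists (x == y). split; [constructor|]. intros; apply iff_intro; auto. Qed.
Lemma delta0_And A B : delta0 A -> delta0 B -> delta0 (A && B).
Proof.
  intros (A' & HA & EA) (B' & HB & EB). exists (A' && B').
  split; [now constructor|].
  intros G; apply iff_intro; intros G' Hs H; fa H H1 H2; fsplit.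
  - now apply (iff_mp _ _ _ (EA _)).
  - now apply (iff_mp _ _ _ (EB _)).
  - now apply (iff_mpr _ _ _ (EA _)).
  - now apply (iff_mpr _ _ _ (EB _)).
Qed.
Lemma delta0_Or A B : delta0 A -> delta0 B -> delta0 (A || B).
Proof.
  intros (A' & HA & EA) (B' & HB & EB). exists (A' || B').
  split; [now constructor|].
  intros G; apply iff_intro; intros G' Hs H; fo H.
  - now apply OrI1, (iff_mp _ _ _ (EA _)).
  - now apply OrI2, (iff_mp _ _ _ (EB _)).
  - now apply OrI1, (iff_mpr _ _ _ (EA _)).
  - now apply OrI2, (iff_mpr _ _ _ (EB _)).
Qed.

(** An equivalence provable in every context holds in the shifted one, so [AllI] generalises it.
    This carries [delta0] through bounded quantifiers. *)
Lemma iff_inst A B : (forall G, G ⊢ A <--> B) -> forall G x, G ⊢ inst x A <--> inst x B.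
Proof. intros H G x. exact (AllE _ _ _ x (AllI _ _ _ (H (map shift G)))). Qed.

Lemma delta0_BAll a A : delta0 A -> delta0 (BAll a A).
Proof.
  intros (B & HB & E). pose proof (iff_inst _ _ E) as E'.
  exists (BAll a B). split; [now constructor|].
  intros G; apply iff_intro; intros G' Hs H; apply bound_intro;
    intros x G2 Hs2 Hx; wk Hs2.
  - apply (iff_mp _ _ _ (E' _ x)). eapply bound_elim; eauto.
  - apply (iff_mpr _ _ _ (E' _ x)). eapply bound_elim; eauto.
Qed.
Lemma delta0_BEx a A : delta0 A -> delta0 (BEx a A).
Proof.
  intros (B & HB & E). pose proof (iff_inst _ _ E) as E'.
  exists (BEx a B). split; [now constructor|].
  intros G; apply iff_intro; intros G' Hs H; apply (bex_elim _ _ _ _ H);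
    intros x G2 Hs2 Hx Hx2; wk Hs2; apply bex_intro with x; auto.
  - now apply (iff_mp _ _ _ (E' _ x)).
  - now apply (iff_mpr _ _ _ (E' _ x)).
Qed.
Lemma delta0_Sub x y : delta0 (Sub x y).
Proof. apply delta0_BAll, delta0_Mem. Qed.

(** ** The axioms as rules *)

Lemma extensionality G a b :
  (forall x G', incl G G' -> G' ⊢ x ∈ a -> G' ⊢ x ∈ b) ->
  (forall x G', incl G G' -> G' ⊢ x ∈ b -> G' ⊢ x ∈ a) -> G ⊢ a == b.
Proof.
  intros H1 H2.
  assert (E : G ⊢ Extensionality) by apply Ax, czf_in, CZF_extensionality.
  fal E a as E1. fal E1 b as E2. eapply ImpE; [exact E2|].
  apply all_intro. intros x. apply iff_intro; intros G' Hs H.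
  - exact (H1 x G' Hs H).
  - exact (H2 x G' Hs H).
Qed.

Lemma pairing G x y C :
  (forall z G', incl G G' -> G' ⊢ UPair z x y -> G' ⊢ C) -> G ⊢ C.
Proof.
  intros H.
  assert (E : G ⊢ Pairing) by apply Ax, czf_in, CZF_pairing.
  fal E x as E1. fal E1 y as E2.
  apply (ex_elim _ _ _ E2). intros z G' Hs Hz. exact (H z G' Hs Hz).
Qed.

Lemma union G a C :
  (forall b G', incl G G' -> G' ⊢ All (0 ∈ S b <--> BEx (S a) (1 ∈ 0)) -> G' ⊢ C) ->
  G ⊢ C.
Proof.
  intros H.
  assert (E : G ⊢ Union) by apply Ax, czf_in, CZF_union.
  fal E a as E1.
  apply (ex_elim _ _ _ E1). intros z G' Hs Hz. exact (H z G' Hs Hz).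
Qed.

Lemma separation G a A C : delta0 A ->
  (forall b G', incl G G' -> G' ⊢ All (0 ∈ S b <--> 0 ∈ S a && A) -> G' ⊢ C) ->
  G ⊢ C.
Proof.
  intros (B & HB & E) H.
  assert (K : G ⊢ Separation B) by now apply Ax, czf_in, CZF_separation.
  pose proof (AllE _ _ _ a K) as K1. cbn [inst ren up] in K1.
  apply (ex_elim _ _ _ K1). intros z G' Hs Hz. apply (H z G' Hs).
  cbn [inst ren up] in Hz.
  replace (ren _ (ren _ (lift 1 2 B))) with B in Hz by ren_solve.
  apply all_intro. intros x. apply iff_intro; intros G2 Hs2 HA; wk Hs2.
  - pose proof (all_iff1 _ _ _ x Hz HA) as K3. fa K3 K4 K5. apply AndI; [exact K4|].
    now apply (iff_mpr _ _ _ (iff_inst _ _ E _ x)).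
  - apply (all_iff2 _ _ _ x Hz). fa HA K4 K5. apply AndI; [exact K4|].
    now apply (iff_mp _ _ _ (iff_inst _ _ E _ x)).
Qed.

Lemma collection G a R C : G ⊢ BAll a (Ex R) ->
  (forall b G', incl G G' -> G' ⊢ BAll a (BEx (S b) R) ->
    G' ⊢ BAll b (BEx (S a) (ren swap R)) -> G' ⊢ C) -> G ⊢ C.
Proof.
  intros HR H.
  assert (K : G ⊢ StrongCollection R) by apply Ax, czf_in, CZF_strong_collection.
  pose proof (AllE _ _ _ a K) as K1.
  unfold TotalBoth, BAll, BEx in *. cbn [inst ren up] in K1.
  replace (ren _ (lift 2 1 R)) with R in K1 by ren_solve.
  pose proof (ImpE _ _ _ _ K1 HR) as K2.
  apply (ex_elim _ _ _ K2). intros b G' Hs Hb. cbn [inst ren up] in Hb.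
  replace (ren _ (ren _ (lift 2 2 R))) with R in Hb by ren_solve.
  replace (ren _ (ren _ (ren swap (lift 2 2 R)))) with (ren swap R) in Hb by ren_solve.
  fa Hb H1 H2. exact (H b G' Hs H1 H2).
Qed.

(** The induction hypothesis of Set Induction as a modality; iterating it reaches the elements of
    elements, and so on. *)
Definition Box (A : fm) : fm := BAll 0 (lift 1 1 A).

Lemma set_induction G A : G ⊢ All (Box A --> A) -> G ⊢ All A.
Proof. apply ImpE. apply Ax, czf_in, CZF_set_induction. Qed.

(** ** Pairs *)

Lemma UPair_l G z x y : G ⊢ UPair z x y -> G ⊢ x ∈ z.
Proof. intros H. apply (all_iff2 _ _ _ x H). apply OrI1, EqRefl. Qed.
Lemma UPair_r G z x y : G ⊢ UPair z x y -> G ⊢ y ∈ z.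
Proof. intros H. apply (all_iff2 _ _ _ y H). apply OrI2, EqRefl. Qed.
Lemma UPair_in G z x y w : G ⊢ UPair z x y -> G ⊢ w ∈ z -> G ⊢ w == x || w == y.
Proof. intros H. apply (all_iff1 _ _ _ w H). Qed.
Lemma single_in G z x w : G ⊢ UPair z x x -> G ⊢ w ∈ z -> G ⊢ w == x.
Proof. intros H K. pose proof (UPair_in _ _ _ _ _ H K) as L. fo L; exact L. Qed.

Lemma UPair_mk G z x y : G ⊢ x ∈ z -> G ⊢ y ∈ z ->
  G ⊢ BAll z (0 == S x || 0 == S y) -> G ⊢ UPair z x y.
Proof.
  intros Hx Hy H. fi w. fsplit; fi K.
  - fbl H w K as L. exact L.
  - fo K; fsubst K; assumption.
Qed.

(** The unbounded half of the definition says no more than that x and y lie in z. *)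
Lemma delta0_UPair z x y : delta0 (UPair z x y).
Proof.
  apply delta0_of with (x ∈ z && y ∈ z && BAll z (0 == S x || 0 == S y)).
  - repeat first [apply delta0_And | apply delta0_BAll | apply delta0_Or |
      apply delta0_Mem | apply delta0_Eq].
  - intros G; apply iff_intro; intros G' Hs H; wk Hs.
    + fsplit; [now apply UPair_l in H|now apply UPair_r in H|].
      fi w K. now apply (UPair_in _ _ _ _ _ H).
    + fa H A B C. now apply UPair_mk.
Qed.

Lemma UPair_ex G x y : G ⊢ Ex (UPair 0 (S x) (S y)).
Proof.
  apply (pairing G x y). intros z G1 H1 Hz. now fex z.
Qed.

(** [OPair] only characterises the elements of z; that {x} and {x, y} exist as sets comes from
    Pairing. *)
Lemma OPair_elems G z x y : G ⊢ OPair z x y ->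
  G ⊢ Ex (Ex (UPair 1 (2 + x) (2 + x) && 1 ∈ (2 + z) &&
              UPair 0 (2 + x) (2 + y) && 0 ∈ (2 + z))).
Proof.
  intros H.
  pose proof (UPair_ex G x x) as K. fx K a.
  pose proof (UPair_ex G x y) as L. fx L b.
  fex a. fex b. fsplit; try assumption.
  - apply (all_iff2 _ _ _ a H). now apply OrI1.
  - apply (all_iff2 _ _ _ b H). now apply OrI2.
Qed.

Lemma OPair_in G z x y w : G ⊢ OPair z x y -> G ⊢ w ∈ z ->
  G ⊢ UPair w x x || UPair w x y.
Proof. intros H. apply (all_iff1 _ _ _ w H). Qed.

Lemma OPair_inj G z x y x' y' : G ⊢ OPair z x y -> G ⊢ OPair z x' y' ->
  G ⊢ x == x' && y == y'.
Proof.
  intros H H'.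
  pose proof (OPair_elems _ _ _ _ H) as L. fx L a. fx L b. fa L Ha Haz Hb Hbz.
  pose proof (OPair_elems _ _ _ _ H') as L. fx L a'. fx L b'. fa L Ha' Haz' Hb' Hbz'.
  assert (E : G ⊢ x' == x).
  { pose proof (OPair_in _ _ _ _ _ H' Haz) as K. fo K;
      apply (single_in _ _ _ _ Ha); now apply UPair_l in K. }
  fsubst E. apply AndI; [apply EqRefl|].
  pose proof (OPair_in _ _ _ _ _ H' Hbz) as K.
  pose proof (OPair_in _ _ _ _ _ H Hbz') as K'.
  apply UPair_r in Hb, Hb'. fo K.
  - pose proof (single_in _ _ _ _ K Hb) as E. fsubst E.
    apply prv_eq_sym. fo K'; [now apply (single_in _ _ _ _ K')|].
    now apply (single_in _ _ _ _ K').
  - pose proof (UPair_in _ _ _ _ _ K Hb) as L. fo L; [|exact L].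
    fsubst L. apply prv_eq_sym. fo K'; now apply (single_in _ _ _ _ K').
Qed.

Lemma UPair_unique G z z' x y : G ⊢ UPair z x y -> G ⊢ UPair z' x y -> G ⊢ z == z'.
Proof.
  intros H H'. apply extensionality; intros w G' Hs K; wk Hs.
  - apply (all_iff2 _ _ _ w H'). exact (all_iff1 _ _ _ w H K).
  - apply (all_iff2 _ _ _ w H). exact (all_iff1 _ _ _ w H' K).
Qed.

Lemma OPair_unique G z z' x y : G ⊢ OPair z x y -> G ⊢ OPair z' x y -> G ⊢ z == z'.
Proof.
  intros H H'. apply extensionality; intros w G' Hs K; wk Hs.
  - apply (all_iff2 _ _ _ w H'). exact (all_iff1 _ _ _ w H K).
  - apply (all_iff2 _ _ _ w H). exact (all_iff1 _ _ _ w H' K).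
Qed.

Lemma OPair_ex G x y : G ⊢ Ex (OPair 0 (S x) (S y)).
Proof.
  pose proof (UPair_ex G x x) as Ha. fx Ha a.
  pose proof (UPair_ex G x y) as Hb. fx Hb b.
  pose proof (UPair_ex G a b) as Hz. fx Hz z.
  fex z. fi w. fsplit; fi K.
  - pose proof (UPair_in _ _ _ _ _ Hz K) as L. fo L; fsubst L; [now apply OrI1|now apply OrI2].
  - fo K.
    + pose proof (UPair_unique _ _ _ _ _ K Ha) as E. fsubst E. now apply UPair_l in Hz.
    + pose proof (UPair_unique _ _ _ _ _ K Hb) as E. fsubst E. now apply UPair_r in Hz.
Qed.

Lemma OPair_mk G z a b x y : G ⊢ UPair a x x -> G ⊢ a ∈ z ->
    G ⊢ UPair b x y -> G ⊢ b ∈ z ->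
    G ⊢ BAll z (UPair 0 (S x) (S x) || UPair 0 (S x) (S y)) -> G ⊢ OPair z x y.
Proof.
  intros Ha Haz Hb Hbz H. fi w. fsplit; fi K.
  - fbl H w K as L. exact L.
  - fo K.
    + pose proof (UPair_unique _ _ _ _ _ K Ha) as E. fsubst E. assumption.
    + pose proof (UPair_unique _ _ _ _ _ K Hb) as E. fsubst E. assumption.
Qed.

Lemma delta0_OPair z x y : delta0 (OPair z x y).
Proof.
  apply delta0_of with (BEx z (UPair 0 (S x) (S x)) && BEx z (UPair 0 (S x) (S y)) &&
    BAll z (UPair 0 (S x) (S x) || UPair 0 (S x) (S y))).
  - repeat first [apply delta0_And | apply delta0_BAll | apply delta0_BEx |
      apply delta0_Or | apply delta0_UPair].
  - intros G; apply iff_intro; intros G' Hs H; wk Hs.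
    + pose proof (OPair_elems _ _ _ _ H) as L. fx L a. fx L b. fa L Ha Haz Hb Hbz.
      fsplit.
      * fbx a; assumption.
      * fbx b; assumption.
      * fi w K. now apply (OPair_in _ _ _ _ _ H).
    + fa H A B C. fx A a Ha. fx B b Hb. now apply OPair_mk with a b.
Qed.

Lemma delta0_PairIn x y r : delta0 (PairIn x y r).
Proof. apply delta0_BEx, delta0_OPair. Qed.

End Sets.

(** * Iterated set induction, products and relations *)

Definition IsUnion (u a : nat) : fm := All (0 ∈ S u <--> BEx (S a) (1 ∈ 0)).
Definition Adj (u t y : nat) : fm := All (0 ∈ S u <--> 0 ∈ S t || 0 == S y).
Definition SProd (m x b : nat) : fm :=
  All (0 ∈ S m <--> BEx (S b) (OPair 1 (2 + x) 0)).
Definition Prod (m a b : nat) : fm :=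
  All (0 ∈ S m <--> BEx (S a) (BEx (2 + b) (OPair 2 1 0))).

Lemma ren_IsUnion f x y : ren f (IsUnion x y) = IsUnion (f x) (f y).
Proof. reflexivity. Qed.
Lemma ren_Adj f x y z : ren f (Adj x y z) = Adj (f x) (f y) (f z).
Proof. reflexivity. Qed.
Lemma ren_SProd f x y z : ren f (SProd x y z) = SProd (f x) (f y) (f z).
Proof. reflexivity. Qed.
Lemma ren_Prod f x y z : ren f (Prod x y z) = Prod (f x) (f y) (f z).
Proof. reflexivity. Qed.
#[local] Hint Rewrite ren_IsUnion ren_Adj ren_SProd ren_Prod : fm.

Ltac delta0 :=
  repeat first [assumption | apply delta0_And | apply delta0_BAll | apply delta0_BEx |
    apply delta0_Or | apply delta0_Mem | apply delta0_Eq | apply delta0_UPair |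
    apply delta0_OPair | apply delta0_PairIn | apply delta0_Sub | apply delta0_Bot].

Tactic Notation "fxe" constr(L) ident(x) ident(H) :=
  pose proof L as H; fx H x.

Section Sets.
Context {T : fm -> Prop} {HT : Theory T}.
Local Notation "G ⊢ A" := (prv T G A) (at level 70).

Lemma delta0_ren A f : delta0 (T := T) A -> delta0 (T := T) (ren f A).
Proof.
  intros (B & HB & E). exists (ren f B). split; [now apply bounded_ren|].
  intros G. apply prv_weak with []; [intros x []|].
  exact (prv_ren [] (A <--> B) (E []) f).
Qed.

Lemma sub_elim G x y z : G ⊢ Sub x y -> G ⊢ z ∈ x -> G ⊢ z ∈ y.
Proof. exact (bound_elim G x (0 ∈ S y) z). Qed.

(** This keeps leaves apart from inner nodes: a label with first component both in S and equal to S
    would give S ∈ S. *)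
Lemma mem_irrefl G x : G ⊢ x ∈ x -> G ⊢ Bot.
Proof.
  intros H. assert (K : G ⊢ All (0 ∈ 0 --> Bot)).
  { apply set_induction. clear H. fi y. fi K. fi L. fbl K y L as M. now apply (ImpE _ _ _ _ M). }
  fal K x as L. exact (ImpE _ _ _ _ L H).
Qed.

Lemma Box_elim G A x y : G ⊢ inst x (Box A) -> G ⊢ y ∈ x -> G ⊢ inst y A.
Proof.
  intros H Hy. pose proof (bound_elim _ _ _ y H Hy) as K.
  unfold lift in K. rewrite ren_ren in K. unfold inst in *. rewrite ren_ren in K.
  erewrite ren_ext; [exact K|]. now intros [|n].
Qed.

Lemma Box_intro G A x :
  (forall y G', incl G G' -> G' ⊢ y ∈ x -> G' ⊢ inst y A) -> G ⊢ inst x (Box A).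
Proof.
  intros H. apply (bound_intro G x). intros y G' Hs Hy.
  replace (inst y _) with (inst y A) by ren_solve. auto.
Qed.

Lemma Box_mono G A B x : (forall G y, G ⊢ inst y A -> G ⊢ inst y B) ->
  G ⊢ inst x (Box A) -> G ⊢ inst x (Box B).
Proof.
  intros H K. apply Box_intro. intros y G' Hs Hy. wk Hs.
  apply H. eapply Box_elim; eauto.
Qed.

Fixpoint boxes (n : nat) (A : fm) : fm :=
  match n with 0 => A | S n => Box (boxes n A) end.
(** A along all membership descents of at most n steps. Set Induction for this stronger formula
    yields a hypothesis n+1 steps down. *)
Fixpoint hered (n : nat) (A : fm) : fm :=
  match n with 0 => A | S n => A && Box (hered n A) end.

Lemma hered_pred n A G x : G ⊢ inst x (hered (S n) A) -> G ⊢ inst x (hered n A).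
Proof.
  revert G x; induction n as [|n IH]; intros G x H; fa H H1 H2; [exact H1|].
  apply AndI; [exact H1|]. now apply (Box_mono _ _ _ _ IH).
Qed.
Lemma hered_boxes n A G x : G ⊢ inst x (hered n A) -> G ⊢ inst x (boxes n A).
Proof.
  revert G x; induction n as [|n IH]; intros G x H; [exact H|].
  fa H H1 H2. now apply (Box_mono _ _ _ _ IH).
Qed.

(** An immediate subtree of x is not an element of x, but it lies in the transitive
    closure of x, five membership steps down. *)
Lemma deep_induction n G A : G ⊢ All (boxes (S n) A --> A) -> G ⊢ All A.
Proof.
  intros H.
  assert (K : G ⊢ All (hered n A)).
  { apply set_induction. apply all_intro. intros x. apply imp_intro. intros G' Hs K. wk Hs.
    assert (L : G ⊢ inst x A).
    { eapply ImpE; [exact (AllE _ _ _ x H)|]. exact (Box_mono _ _ _ _ (hered_boxes n A) K). }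
    destruct n as [|n]; [exact L|]. apply AndI; [exact L|].
    exact (Box_mono _ _ _ _ (hered_pred n A) K). }
  apply all_intro. intros x. pose proof (AllE _ _ _ x K) as L.
  destruct n; [exact L|]. now fa L L1 L2.
Qed.

Lemma union_ex G a : G ⊢ Ex (IsUnion 0 (S a)).
Proof. apply (union G a). intros b G1 Hs Hb. now fex b. Qed.

Lemma empty_ex G : G ⊢ Ex (Empty 0).
Proof.
  (* Here 0 is a variable, denoting an arbitrary set to separate from. *)
  apply (separation G 0 Bot); [apply delta0_Bot|]. intros b G1 Hs Hb. fex b.
  fi x. fi H. pose proof (all_iff1 _ _ _ x Hb H) as K. now fa K K1 K2.
Qed.

Lemma IsUnion_intro G u a x y : G ⊢ IsUnion u a -> G ⊢ y ∈ a -> G ⊢ x ∈ y -> G ⊢ x ∈ u.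
Proof. intros H Ha Hx. apply (all_iff2 _ _ _ x H). fs. now fbx y. Qed.

Lemma IsUnion_elim G u a x : G ⊢ IsUnion u a -> G ⊢ x ∈ u -> G ⊢ BEx a (S x ∈ 0).
Proof. intros H Hx. exact (all_iff1 _ _ _ x H Hx). Qed.

Lemma Adj_ex G t y : G ⊢ Ex (Adj 0 (S t) (S y)).
Proof.
  fxe (UPair_ex G y y) a Ha. fxe (UPair_ex G t a) b Hb. fxe (union_ex G b) u Hu.
  fex u. fi x. fsplit; fi K.
  - pose proof (IsUnion_elim _ _ _ _ Hu K) as L. fx L z Hz.
    pose proof (UPair_in _ _ _ _ _ Hb Hz) as M. fo M; fsubst M.
    + now apply OrI1.
    + apply OrI2. now apply (single_in _ _ _ _ Ha).
  - fo K.
    + apply (IsUnion_intro _ _ _ x t Hu); [|exact K]. now apply UPair_l in Hb.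
    + fsubst K. apply (IsUnion_intro _ _ _ y a Hu); [now apply UPair_r in Hb|].
      now apply UPair_l in Ha.
Qed.

Lemma Adj_new G u t y : G ⊢ Adj u t y -> G ⊢ y ∈ u.
Proof. intros H. apply (all_iff2 _ _ _ y H). apply OrI2, EqRefl. Qed.
Lemma Adj_old G u t y x : G ⊢ Adj u t y -> G ⊢ x ∈ t -> G ⊢ x ∈ u.
Proof. intros H K. apply (all_iff2 _ _ _ x H). now apply OrI1. Qed.
Lemma Adj_in G u t y x : G ⊢ Adj u t y -> G ⊢ x ∈ u -> G ⊢ x ∈ t || x == y.
Proof. intros H. exact (all_iff1 _ _ _ x H). Qed.

Lemma collection_ex G a R : G ⊢ BAll a (Ex R) ->
  G ⊢ Ex (BAll (S a) (BEx 1 (lift 2 1 R)) && BAll 0 (BEx (2 + a) (ren swap (lift 2 1 R)))).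
Proof.
  intros H. apply (collection G a R _ H). intros b G' Hs H1 H2.
  apply ExI with b. apply AndI; unfold BAll, BEx in *; cbn.
  - replace (ren _ (lift 2 1 R)) with R by ren_solve. exact H1.
  - replace (ren _ (ren swap (lift 2 1 R))) with (ren swap R) by ren_solve. exact H2.
Qed.

Lemma separation_ex G a A : delta0 (T := T) A ->
  G ⊢ Ex (All (0 ∈ 1 <--> 0 ∈ (2 + a) && lift 1 1 A)).
Proof.
  intros H. apply (separation G a A _ H). intros b G' Hs Hb.
  apply ExI with b. cbn. replace (ren _ (lift 1 1 A)) with A by ren_solve. exact Hb.
Qed.

(** The second half of Strong Collection ensures that the collected set contains nothing but the
    pairs (x, y). *)
Lemma SProd_ex G x b : G ⊢ Ex (SProd 0 (S x) (S b)).
Proof.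
  assert (H : G ⊢ BAll b (Ex (OPair 0 (2 + x) 1))).
  { fi y Hy. apply OPair_ex. }
  apply collection_ex in H. fx H m. fa H H1 H2. fex m. fi z. fsplit; fi K.
  - now fbl H2 z K as L.
  - fx K y Hy. fbl H1 y Hy as L. fx L z' Hz'.
    pose proof (OPair_unique _ _ _ _ _ K L) as E. now fsubst E.
Qed.

Lemma Prod_ex G a b : G ⊢ Ex (Prod 0 (S a) (S b)).
Proof.
  assert (H : G ⊢ BAll a (Ex (SProd 0 1 (2 + b)))).
  { fi x Hx. apply SProd_ex. }
  apply collection_ex in H. fx H M. fa H H1 H2. fxe (union_ex G M) u Hu.
  fex u. fi z. fsplit; fi K.
  - pose proof (IsUnion_elim _ _ _ _ Hu K) as L. fx L m Hm.
    fbl H2 m Hm as N. fx N x Hx. fbx x; [exact Hx|].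
    exact (all_iff1 _ _ _ z N L).
  - fx K x Hx. fbl H1 x Hx as L. fx L m Hm.
    apply (IsUnion_intro _ _ _ z m Hu Hm). exact (all_iff2 _ _ _ z L K).
Qed.

Lemma Prod_intro G m a b x y z : G ⊢ Prod m a b -> G ⊢ x ∈ a -> G ⊢ y ∈ b ->
  G ⊢ OPair z x y -> G ⊢ z ∈ m.
Proof. intros H Hx Hy Hz. apply (all_iff2 _ _ _ z H). fs. fbx x; auto. fbx y; auto. Qed.

Lemma Prod_elim G m a b z : G ⊢ Prod m a b -> G ⊢ z ∈ m ->
  G ⊢ BEx a (BEx (S b) (OPair (2 + z) 1 0)).
Proof. intros H Hz. exact (all_iff1 _ _ _ z H Hz). Qed.

(** ** Relations and functions *)

Lemma PairIn_intro G x y z r : G ⊢ OPair z x y -> G ⊢ z ∈ r -> G ⊢ PairIn x y r.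
Proof. intros H Hr. unfold PairIn. now fbx z. Qed.

Lemma PairIn_sub G x y r r' : G ⊢ Sub r r' -> G ⊢ PairIn x y r -> G ⊢ PairIn x y r'.
Proof.
  intros H K. fx K z Hz. apply (PairIn_intro _ _ _ z); auto. eapply sub_elim; eauto.
Qed.

Lemma PairIn_elem G x y r z : G ⊢ OPair z x y -> G ⊢ PairIn x y r -> G ⊢ z ∈ r.
Proof.
  intros H K. fx K w Hw. pose proof (OPair_unique _ _ _ _ _ H K) as E. now fsubst E.
Qed.

Lemma PairIn_field G x y r u v : G ⊢ IsUnion u r -> G ⊢ IsUnion v u ->
  G ⊢ PairIn x y r -> G ⊢ x ∈ v && y ∈ v.
Proof.
  intros Hu Hv H. fx H z Hz.
  pose proof (OPair_elems _ _ _ _ H) as L. fx L a. fx L b. fa L Ha Haz Hb Hbz.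
  pose proof (IsUnion_intro _ _ _ _ _ Hu Hz Hbz) as K.
  apply AndI; apply (IsUnion_intro _ _ _ _ _ Hv K);
    [now apply UPair_l in Hb|now apply UPair_r in Hb].
Qed.

Lemma OPair_bound G z x y : G ⊢ OPair z x y -> G ⊢ BEx z (S x ∈ 0 && S y ∈ 0).
Proof.
  intros H. pose proof (OPair_elems _ _ _ _ H) as L. fx L a. fx L b. fa L Ha Haz Hb Hbz.
  fbx b; [exact Hbz|]. apply AndI; [now apply UPair_l in Hb|now apply UPair_r in Hb].
Qed.

(** The graph {(x, y) ∈ a × b | R(x, y)}, where y is variable 0 and x variable 1 of R, as in the
    collection schemes. *)
Definition Rel (r a b : nat) (R : fm) : fm :=
  BAll r (BEx (S a) (BEx (2 + b) (OPair 2 1 0 && lift 2 1 R))) &&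
  BAll a (BAll (S b) (R --> PairIn 1 0 (2 + r))).

Lemma Rel_ex G a b R C : delta0 (T := T) R ->
  (forall r G', incl G G' -> G' ⊢ Rel r a b R -> G' ⊢ C) -> G ⊢ C.
Proof.
  intros HR HC. apply (ex_elim _ _ _ (Prod_ex G a b)). intros P G1 Hs HP. fs_in HP.
  apply (separation G1 P (BEx (S a) (BEx (2 + b) (OPair 2 1 0 && lift 2 1 R)))).
  { delta0. now apply delta0_ren. }
  intros r G2 Hs2 Hr. apply (HC r G2 (incl_tran Hs Hs2)). wk Hs2. clear HC Hs.
  apply AndI.
  - apply bound_intro. intros c G' Hs Hc. wk Hs.
    pose proof (all_iff1 _ _ _ c Hr Hc) as K. fa K K1 K2. exact K2.
  - apply bound_intro. intros x G' Hs Hx. wk Hs.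
    apply bound_intro. intros y G' Hs Hy. wk Hs.
    cbn [inst ren]. apply imp_intro. intros G' Hs K. wk Hs.
    fxe (OPair_ex G2 x y) z Hz. fs. fs_in HP. apply (PairIn_intro _ _ _ z); [exact Hz|].
    apply (all_iff2 _ _ _ z Hr). fs. apply AndI; [eapply Prod_intro; eauto|].
    apply bex_intro with x; [exact Hx|]. apply bex_intro with y; [exact Hy|].
    apply AndI; [exact Hz|]. unfold inst in K. rewrite ren_ren in K.
    unfold inst, lift. rewrite !ren_ren. erewrite ren_ext; [exact K|].
    now intros [|[|n]].
Qed.

Lemma Rel_intro G r a b R x y : G ⊢ Rel r a b R -> G ⊢ x ∈ a -> G ⊢ y ∈ b ->
  G ⊢ ren (y .: x .: idn) R -> G ⊢ PairIn x y r.
Proof.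
  intros H Hx Hy K. fa H H1 H2.
  pose proof (bound_elim _ _ _ x H2 Hx) as L.
  pose proof (bound_elim _ _ _ y L Hy) as M.
  eapply ImpE; [exact M|]. unfold inst. rewrite ren_ren.
  erewrite ren_ext; [exact K|]. now intros [|[|n]].
Qed.

Lemma Rel_elem G r a b R z : G ⊢ Rel r a b R -> G ⊢ z ∈ r ->
  G ⊢ BEx a (BEx (S b) (OPair (2 + z) 1 0 && R)).
Proof.
  intros H Hz. fa H H1 H2. pose proof (bound_elim _ _ _ z H1 Hz) as L.
  unfold BEx in *. cbn in L.
  replace (ren _ (lift 2 1 R)) with R in L by ren_solve. exact L.
Qed.

Lemma Rel_elim G r a b R x y : G ⊢ Rel r a b R -> G ⊢ PairIn x y r ->
  G ⊢ x ∈ a && y ∈ b && ren (y .: x .: idn) R.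
Proof.
  intros H K. fx K z Hz. pose proof (Rel_elem _ _ _ _ _ _ H Hz) as L.
  apply (bex_elim _ _ _ _ L). intros x' G' Hs Hx' M. wk Hs.
  apply (bex_elim _ _ _ _ M). intros y' G' Hs Hy' N. wk Hs.
  fa N N1 N2. fs_in N1. clear L M H.
  pose proof (OPair_inj _ _ _ _ _ _ N1 K) as E. fa E E1 E2.
  (* R is schematic, so the two equations are applied one at a time, each after a renaming that
     makes the replaced variable 0. *)
  assert (P : G ⊢ inst x' (ren (S y' .: 0 .: S) R)).
  { unfold inst in *. rewrite ren_ren in *. erewrite ren_ext; [exact N2|].
    now intros [|[|n]]. }
  apply (EqSubst _ _ _ _ x E1) in P.
  assert (P' : G ⊢ inst y' (ren (0 .: S x .: S) R)).
  { unfold inst in *. rewrite ren_ren in *. erewrite ren_ext; [exact P|].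
    now intros [|[|n]]. }
  apply (EqSubst _ _ _ _ y E2) in P'.
  apply AndI; [apply AndI|].
  - exact (EqSubst _ _ (0 ∈ S a) _ _ E1 Hx').
  - exact (EqSubst _ _ (0 ∈ S b) _ _ E2 Hy').
  - unfold inst in *. rewrite ren_ren in *. erewrite ren_ext; [exact P'|].
    now intros [|[|n]].
Qed.

Lemma Fun_total G f a b x : G ⊢ Fun f a b -> G ⊢ x ∈ a -> G ⊢ Ex (PairIn (S x) 0 (S f)).
Proof. intros H Hx. fa H H1 H2 H3. now fbl H2 x Hx as K. Qed.

Lemma Fun_eq G f a b x y y' : G ⊢ Fun f a b -> G ⊢ PairIn x y f -> G ⊢ PairIn x y' f ->
  G ⊢ y == y'.
Proof.
  intros H K K'. fa H H1 H2 H3. fal H3 x as L. fal L y as M. fal M y' as N.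
  eapply ImpE; [eapply ImpE; [exact N|exact K]|exact K'].
Qed.

Lemma Fun_elem G f a b z : G ⊢ Fun f a b -> G ⊢ z ∈ f ->
  G ⊢ BEx a (BEx (S b) (OPair (2 + z) 1 0)).
Proof. intros H Hz. fa H H1 H2 H3. now fbl H1 z Hz as K. Qed.

Lemma Fun_dom_cod G f a b x y : G ⊢ Fun f a b -> G ⊢ PairIn x y f -> G ⊢ x ∈ a && y ∈ b.
Proof.
  intros H K. fx K z Hz. pose proof (Fun_elem _ _ _ _ _ H Hz) as L.
  fx L x' Hx. fx L y' Hy. pose proof (OPair_inj _ _ _ _ _ _ K L) as E. fa E E1 E2.
  fsubst E1. fsubst E2. now apply AndI.
Qed.

Lemma Rel_Fun G r a b R : G ⊢ Rel r a b R ->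
  G ⊢ BAll a (BEx (S b) R) ->
  G ⊢ All (All (All (PairIn 2 1 (3 + r) --> PairIn 2 0 (3 + r) --> 1 == 0))) ->
  G ⊢ Fun r a b.
Proof.
  intros H K L. apply AndI; [apply AndI|exact L].
  - apply bound_intro. intros z G' Hs Hz. wk Hs. fs.
    pose proof (Rel_elem _ _ _ _ _ _ H Hz) as M.
    apply (bex_elim _ _ _ _ M). intros x' G' Hs Hx' N. wk Hs. clear M.
    apply (bex_elim _ _ _ _ N). intros y' G' Hs Hy' M. wk Hs. clear N.
    fa M M1 M2. fbx x'; [exact Hx'|]. fbx y'; [exact Hy'|]. exact M1.
  - apply bound_intro. intros x G' Hs Hx. wk Hs. fs.
    pose proof (bound_elim _ _ _ x K Hx) as M.
    apply (bex_elim _ _ _ _ M). intros y G' Hs Hy N. wk Hs. fex y.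
    eapply Rel_intro; eauto. unfold inst in N. rewrite ren_ren in N.
    erewrite ren_ext; [exact N|]. now intros [|[|n]].
Qed.

Lemma Surj_Fun G f a b : G ⊢ Surj f a b -> G ⊢ Fun f a b.
Proof. intros H. now fa H H1 H2. Qed.

Lemma Surj_onto G f a b y : G ⊢ Surj f a b -> G ⊢ y ∈ b -> G ⊢ BEx a (PairIn 0 (S y) (S f)).
Proof. intros H Hy. fa H H1 H2. now fbl H2 y Hy as K. Qed.

End Sets.

(** [GFP y Γ]: y lies in a set T with Γ(y', T) for all y' ∈ T. In Γ, variable 0 is
    y' and variable 1 is T. *)
Definition GFP (y : nat) (Γ : fm) : fm := Ex (S y ∈ 0 && BAll 0 Γ).
Definition at2 (Γ : fm) (y t : nat) : fm := ren (y .: t .: idn) Γ.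
Definition Good (t : nat) (Γ : fm) : fm := BAll t (ren (up (t .: idn)) Γ).

(** [InI], [WTree] and [DerP] all rest on sets closed backwards under a monotone step. Such sets can
    be united and extended; well-foundedness comes from elsewhere, from the ranks s for [InI] and
    from membership descent in the trees for the others. *)
Definition monotone (T : fm -> Prop) (Γ : fm) : Prop :=
  forall G t t' y, prv T G (Sub t t') -> prv T G (at2 Γ y t) -> prv T G (at2 Γ y t').

Definition StepI (p : nat) (U : fm) : fm :=
  Ex (Ex (OPair 2 1 0 &&
    (lift 1 3 U || Ex (PairIn 0 1 (5 + p) && BAll 0 (BEx 3 (PairIn 0 1 6)))))).
(** [StepI] at a named y and t: the general facts on [GFP] need a formula with two designated
    variables, while arguments about a single step need this form. *)
Definition StepAt (p : nat) (U : fm) (y t : nat) : fm :=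
  Ex (Ex (OPair (2 + y) 1 0 &&
    (lift 1 1 U || Ex (PairIn 0 1 (3 + p) && BAll 0 (BEx 3 (PairIn 0 1 (5 + t))))))).

(** a ∈ I(Φ,U): for some set t of pairs (s, a), a occurs in t, and for (s, a) ∈ t
    either a ∈ U or there is (X, a) ∈ Φ such that every b ∈ X has (s', b) ∈ t for
    some s' ∈ s. *)
Definition InI (p : nat) (U : fm) (a : nat) : fm :=
  Ex (BAll 0 (StepI p U) && Ex (PairIn 0 (2 + a) 1)).
Definition IndClass (s p : nat) (U : fm) : fm := InI (S p) (lift 1 1 U) 0.

Lemma ren_InI f p U a : ren f (InI p U a) = InI (f p) (ren (up f) U) (f a).
Proof.
  unfold InI, StepI, BAll, BEx, PairIn, OPair, UPair. cbn.
  repeat f_equal. ren_solve.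
Qed.

Lemma at1_IndClass s p U a : at1 (IndClass s p U) a = InI p U a.
Proof.
  unfold at1, IndClass. rewrite ren_InI. cbn [scons]. f_equal. ren_solve.
Qed.

Lemma ren_SetCls f u : ren (up f) (SetCls u) = SetCls (f u).
Proof. reflexivity. Qed.

#[local] Hint Rewrite ren_InI ren_SetCls : fm.

Lemma at2_StepI p U y t : at2 (StepI p U) y t = StepAt p U y t.
Proof.
  unfold at2, StepI, StepAt, BAll, BEx, PairIn, OPair, UPair. cbn.
  repeat f_equal. ren_solve.
Qed.

Lemma ren_GFP f y Γ : ren f (GFP y Γ) = GFP (f y) (ren (up (up f)) Γ).
Proof. reflexivity. Qed.

Lemma ren_Good f t Γ : ren f (Good t Γ) = Good (f t) (ren (up (up f)) Γ).
Proof.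
  unfold Good. rewrite ren_BAll. f_equal. rewrite !ren_ren. apply ren_ext.
  now intros [|[|n]].
Qed.

#[local] Hint Rewrite ren_GFP ren_Good : fm.

Ltac fold_at C a H :=
  match type of H with context [ren ?f C] =>
    replace (ren f C) with (at1 C a) in H by ren_solve end.
Ltac goal_at C a :=
  match goal with |- context [ren ?f C] =>
    replace (ren f C) with (at1 C a) by ren_solve end.

Ltac fold_id C H :=
  match type of H with context [ren ?f C] =>
    replace (ren f C) with C in H by ren_solve end.
Ltac goal_id C :=
  match goal with |- context [ren ?f C] =>
    replace (ren f C) with C by ren_solve end.

Section Classes.
Context {T : fm -> Prop} {HT : Theory T}.
Local Notation "G ⊢ A" := (prv T G A) (at level 70).

Lemma Good_elim G t Γ y : G ⊢ Good t Γ -> G ⊢ y ∈ t -> G ⊢ at2 Γ y t.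
Proof.
  intros H Hy. pose proof (bound_elim _ _ _ y H Hy) as K.
  unfold inst in K. rewrite ren_ren in K. unfold at2.
  erewrite ren_ext; [exact K|]. now intros [|[|n]].
Qed.

Lemma Good_intro G t Γ :
  (forall y G', incl G G' -> G' ⊢ y ∈ t -> G' ⊢ at2 Γ y t) -> G ⊢ Good t Γ.
Proof.
  intros H. apply bound_intro. intros y G' Hs Hy.
  unfold inst. rewrite ren_ren. erewrite ren_ext; [exact (H y G' Hs Hy)|].
  now intros [|[|n]].
Qed.

Lemma GFP_intro G t Γ y : G ⊢ Good t Γ -> G ⊢ y ∈ t -> G ⊢ GFP y Γ.
Proof. intros H Hy. apply ExI with t. apply AndI; [exact Hy|exact H]. Qed.

Lemma GFP_elim G Γ y C : G ⊢ GFP y Γ ->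
  (forall t G', incl G G' -> G' ⊢ y ∈ t -> G' ⊢ Good t Γ -> G' ⊢ C) -> G ⊢ C.
Proof.
  intros H HC. apply (ex_elim _ _ _ H). intros t G' Hs K. fa K K1 K2.
  exact (HC t G' Hs K1 K2).
Qed.

(** A union of good sets is good by monotonicity. Strong Collection replaces a choice of one good
    set per element, and its second half guarantees that only good sets are collected. *)
Lemma GFP_collect G e Γ : monotone T Γ ->
  (forall y G', incl G G' -> G' ⊢ y ∈ e -> G' ⊢ GFP y Γ) ->
  G ⊢ Ex (Sub (S e) 0 && Good 0 (lift 2 1 Γ)).
Proof.
  intros Hm H.
  assert (K : G ⊢ BAll e (Ex (1 ∈ 0 && Good 0 (lift 2 2 Γ)))).
  { apply bound_intro. intros y G' Hs Hy.
    apply (GFP_elim _ _ _ _ (H y G' Hs Hy)). intros t G2 _ Hyt Ht.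
    apply ExI with t. apply AndI; [exact Hyt|]. unfold inst. rewrite !ren_Good.
    replace (ren _ (ren _ (lift 2 2 Γ))) with Γ by ren_solve. exact Ht. }
  clear H. apply (collection _ _ _ _ K). intros M G' Hs H1 H2. wk Hs.
  fxe (union_ex G M) u Hu. apply ExI with u. apply AndI.
  - change (G ⊢ Sub e u). ri y Hy.
    pose proof (bound_elim _ _ _ y H1 Hy) as L.
    rx L t Ht. fa L N1 N2.
    exact (IsUnion_intro _ _ _ _ _ Hu Ht N1).
  - rewrite ren_Good.
    replace (ren _ (lift 2 1 Γ)) with Γ by ren_solve.
    apply Good_intro. intros y G1 Hs Hy. wk Hs.
    pose proof (IsUnion_elim _ _ _ _ Hu Hy) as L. fx L t Ht.
    pose proof (bound_elim _ _ _ t H2 Ht) as N.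
    fs_in N. fx N y' Hy'. fa N N1 N2. apply Hm with t.
    + fi w Hw. exact (IsUnion_intro _ _ _ _ _ Hu Ht Hw).
    + apply Good_elim; [|exact L]. 
      match type of N2 with context [ren ?f Γ] => replace (ren f Γ) with Γ in N2 by ren_solve end.
      exact N2.
Qed.

(** Closure under the step: t with y adjoined is again good. *)
Lemma GFP_add G t y Γ : monotone T Γ -> G ⊢ Good t Γ -> G ⊢ at2 Γ y t -> G ⊢ GFP y Γ.
Proof.
  intros Hm Ht Hy. fxe (Adj_ex G t y) u Hu.
  assert (K : G ⊢ Sub t u) by (fi w Hw; exact (Adj_old _ _ _ _ _ Hu Hw)).
  apply GFP_intro with u; [|exact (Adj_new _ _ _ _ Hu)].
  apply Good_intro. intros z G' Hs Hz. wk Hs.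
  pose proof (Adj_in _ _ _ _ _ Hu Hz) as L. fo L.
  - apply (Hm _ _ _ _ K). now apply Good_elim.
  - apply (Hm _ _ _ _ K). apply prv_eq_sym in L.
    replace (at2 Γ z t) with (inst z (ren (0 .: S t .: S) Γ))
      by (unfold inst, at2; rewrite ren_ren; apply ren_ext; now intros [|[|n]]).
    apply (EqSubst _ _ _ y z L).
    replace (inst y (ren (0 .: S t .: S) Γ)) with (at2 Γ y t)
      by (unfold inst, at2; rewrite ren_ren; apply ren_ext; now intros [|[|n]]).
    exact Hy.
Qed.

(** ** The class I(Φ,U) *)

Lemma StepI_mono p U : monotone T (StepI p U).
Proof.
  intros G t t' y Ht. rewrite !at2_StepI. intros H.
  fx H s. fx H a. fa H H1 H2. fex s. fex a. apply AndI; [exact H1|].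
  fo H2; [now apply OrI1|]. apply OrI2. fx H2 x. fa H2 H2 H3. fex x.
  apply AndI; [exact H2|]. fi b Hb. fbl H3 b Hb as K. fx K s' Hs'. fbx s'; [exact Hs'|].
  exact (PairIn_sub _ _ _ _ _ Ht K).
Qed.

Lemma InI_of_GFP G p U s a y : G ⊢ OPair y s a -> G ⊢ GFP y (StepI p U) ->
  G ⊢ InI p U a.
Proof.
  intros H K. apply (GFP_elim _ _ _ _ K). intros t G' Hs Hy Ht. wk Hs.
  apply ExI with t. apply AndI; [exact Ht|]. fex s. exact (PairIn_intro _ _ _ _ _ H Hy).
Qed.

Lemma InI_pair G p U a : G ⊢ InI p U a ->
  G ⊢ Ex (Ex (OPair 0 1 (2 + a) && GFP 0 (lift 2 2 (StepI p U)))).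
Proof.
  intros H. rx H t. fa H K1 K2.
  change (G ⊢ Good t (StepI p U)) in K1. fx K2 s. fx K2 y Hy.
  fex s. fex y. apply AndI; [exact K2|]. goal_id (StepI p U).
  now apply GFP_intro with t.
Qed.

Lemma InI_base G p U a : G ⊢ at1 U a -> G ⊢ InI p U a.
Proof.
  (* The empty set is both the rank of a and the good set to which the pair is adjoined. *)
  intros H. fxe (empty_ex G) e He. fxe (OPair_ex G e a) y Hy.
  apply (InI_of_GFP _ _ _ e a y Hy). apply GFP_add with e.
  - apply StepI_mono.
  - apply Good_intro. intros z G' Hs Hz. wk Hs. apply BotE. now fbl He z Hz as K.
  - rewrite at2_StepI. fex e. fex a. apply AndI; [exact Hy|]. apply OrI1.
    goal_at U a. exact H.
Qed.

Lemma Closed_intro G p C :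
  (forall x a G', incl G G' -> G' ⊢ PairIn x a p -> G' ⊢ BAll x C -> G' ⊢ at1 C a) ->
  G ⊢ Closed p C.
Proof.
  intros H. apply all_intro. intros x. apply all_intro. intros a.
  gsimp. apply imp_intro. intros G1 H1 K1.
  apply imp_intro. intros G2 H2 K2.
  repeat rewrite ren_ren. goal_at C a. apply (H x a G2 (incl_tran H1 H2)).
  - exact (prv_weak _ _ _ _ H2 K1).
  - unfold BAll in *. cbn in K2.
    replace (ren _ (ren _ (lift 1 2 C))) with C in K2 by ren_solve. exact K2.
Qed.

Lemma Closed_elim G p C x a :
  G ⊢ Closed p C -> G ⊢ PairIn x a p -> G ⊢ BAll x C -> G ⊢ at1 C a.
Proof.
  intros H K L. fal H x as M. fal M a as N. fold_at C a N.
  eapply ImpE; [eapply ImpE; [exact N|exact K]|].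
  match goal with |- context [ren ?f C] => replace (ren f C) with C by ren_solve end.
  exact L.
Qed.

Lemma bound_at G x C y : G ⊢ BAll x C -> G ⊢ y ∈ x -> G ⊢ at1 C y.
Proof. apply bound_elim. Qed.

Lemma sub_at G B C y : G ⊢ SubCls B C -> G ⊢ at1 B y -> G ⊢ at1 C y.
Proof. intros H K. eapply ImpE; [exact (AllE _ _ _ y H)|exact K]. Qed.

Lemma InI_step G p U x a : G ⊢ PairIn x a p ->
  (forall b G', incl G G' -> G' ⊢ b ∈ x -> G' ⊢ InI p U b) -> G ⊢ InI p U a.
Proof.
  intros H HX.
  assert (K : G ⊢ BAll x (Ex (Ex (OPair 1 0 2 && GFP 1 (lift 2 3 (StepI p U)))))).
  { apply bound_intro. intros b G' Hs Hb. pose proof (HX b G' Hs Hb) as K.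
    clear HX Hs. apply InI_pair in K. fx K s. fx K y. fs. fex y. fex s.
    fold_id (StepI p U) K. goal_id (StepI p U). exact K. }
  clear HX. apply collection_ex in K. fx K e. fa K K1 K2.
  pose proof (GFP_collect G e _ (StepI_mono p U)) as L.
  lapply L; clear L; [intros L|].
  2:{ intros y G' Hs Hy. wk Hs. fbl K2 y Hy as M. fx M b Hb. fx M s.
      fa M M1 M2. fold_id (StepI p U) M2. exact M2. }
  fx L t. fold_id (StepI p U) L. fa L Het Ht.
  (* Both components of every pair in t lie in ⋃⋃t, so v contains the ranks of all premises and can
     be the rank of a. *)
  fxe (union_ex G t) u Hu. fxe (union_ex G u) v Hv. fxe (OPair_ex G v a) y Hy.
  apply (InI_of_GFP _ _ _ v a y Hy). apply GFP_add with t; [apply StepI_mono|exact Ht|].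
  rewrite at2_StepI. fex v. fex a. apply AndI; [exact Hy|]. apply OrI2.
  fex x. apply AndI; [exact H|]. fi b Hb. fbl K1 b Hb as M. fx M z Hz. fx M s.
  fa M M1 M2. clear M2.
  assert (N : G ⊢ PairIn s b t).
  { apply (PairIn_intro _ _ _ _ _ M1). eapply sub_elim; eauto. }
  fbx s; [|exact N]. pose proof (PairIn_field _ _ _ _ _ _ Hu Hv N) as P. now fa P P1 P2.
Qed.

Lemma SubCls_intro G B C :
  (forall x G', incl G G' -> G' ⊢ at1 B x -> G' ⊢ at1 C x) -> G ⊢ SubCls B C.
Proof. intros H. apply all_intro. intros x. exact (imp_intro G _ _ (H x)). Qed.

Lemma Closed_IndClass G s p U : G ⊢ Closed p (IndClass s p U).
Proof.
  apply Closed_intro. intros x a G' Hs H K. wk Hs. rewrite at1_IndClass.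
  apply InI_step with x; [exact H|]. intros b G' Hs Hb. wk Hs.
  rewrite <- (at1_IndClass s). now apply bound_at with x.
Qed.

Lemma InI_ind G p U C a : G ⊢ Closed p C -> G ⊢ SubCls U C -> G ⊢ InI p U a ->
  G ⊢ at1 C a.
Proof.
  intros Hc Hu H. rx H t. fa H Ht H. change (G ⊢ Good t (StepI p U)) in Ht.
  (* Set Induction on the rank s inside the fixed set t, for all b at once. *)
  assert (K : G ⊢ All (All (PairIn 1 0 (2 + t) --> lift 1 1 C))).
  { apply set_induction. clear H. apply all_intro. intros s. cbn [inst ren].
    apply imp_intro. intros G' Hs IH. wk Hs. apply (all_intro). intros b.
    gsimp. apply imp_intro. intros G' Hs H. wk Hs.
    change (G ⊢ PairIn s b t) in H. repeat rewrite ren_ren. goal_at C b.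
    fx H y Hy. pose proof (Good_elim _ _ _ _ Ht Hy) as L. rewrite at2_StepI in L.
    fx L s'. fx L b'. fa L L1 L2.
    pose proof (OPair_inj _ _ _ _ _ _ L1 H) as E. fa E E1 E2.
    fo L2.
    - fold_at U b' L2. fsubst E2. now apply (sub_at _ U).
    - fx L2 x. fa L2 M1 M2. fsubst E2. apply (Closed_elim _ _ _ x b Hc M1).
      fsubst E1. ri c Hcx. change (G ⊢ at1 C c). fbl M2 c Hcx as N. fx N s2 Hs2.
      pose proof (Box_elim _ _ _ _ IH Hs2) as IH'. fs_in IH'.
      fal IH' c as P. fold_at C c P. exact (ImpE _ _ _ _ P N). }
  fx H s. fal K s as L. fal L a as M. fold_at C a M. exact (ImpE _ _ _ _ M H).
Qed.

Lemma SubCls_IndClass G s p U : G ⊢ SubCls U (IndClass s p U).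
Proof.
  apply SubCls_intro. intros a G' Hs H. wk Hs. rewrite at1_IndClass. now apply InI_base.
Qed.

Lemma PairIn_IndDef G s p x a : G ⊢ IndDef s p -> G ⊢ PairIn x a p ->
  G ⊢ Sub x s && a ∈ s.
Proof.
  intros H K. fx K y Hy. fbl H y Hy as L. fx L x'. fx L a'. fa L L1 L2 L3.
  pose proof (OPair_inj _ _ _ _ _ _ K L1) as E. fa E E1 E2. fsubst E1. fsubst E2.
  now apply AndI.
Qed.

Lemma Closed_S G s p : G ⊢ IndDef s p -> G ⊢ Closed p (SetCls s).
Proof.
  intros H. apply Closed_intro. intros x a G' Hs K _. wk Hs.
  pose proof (PairIn_IndDef _ _ _ _ _ H K) as L. now fa L L1 L2.
Qed.

Lemma InI_sub G s p U a : G ⊢ IndDef s p -> G ⊢ SubCls U (SetCls s) ->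
  G ⊢ InI p U a -> G ⊢ a ∈ s.
Proof. intros H K. exact (InI_ind G p U (SetCls s) a (Closed_S _ _ _ H) K). Qed.

Lemma IndClass_least s p U : IsLeastClosed T s p U (IndClass s p U).
Proof.
  split.
  - set (G := [_; _]).
    assert (H1 : G ⊢ IndDef s p) by (apply Hyp; now left).
    assert (H2 : G ⊢ SubCls U (SetCls s)) by (apply Hyp; right; now left).
    clearbody G. apply AndI; [apply AndI|].
    + apply SubCls_intro. intros a G' Hs H. wk Hs. rewrite at1_IndClass in H.
      exact (InI_sub _ _ _ _ _ H1 H2 H).
    + apply Closed_IndClass.
    + apply SubCls_IndClass.
  - intros C. apply imp_intro. intros G _ H. fa H H1 H2 H3.
    apply SubCls_intro. intros a G' Hs H. wk Hs. rewrite at1_IndClass in H.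
    exact (InI_ind _ _ _ _ _ H2 H3 H).
Qed.

Lemma InI_mono G p u v a : G ⊢ Sub u v -> G ⊢ InI p (SetCls u) a -> G ⊢ InI p (SetCls v) a.
Proof.
  intros H K. rewrite <- (at1_IndClass 0 p).
  apply (InI_ind _ p (SetCls u)); [apply Closed_IndClass| |exact K].
  apply SubCls_intro. intros x G' Hs L. wk Hs. rewrite at1_IndClass.
  apply InI_base. exact (sub_elim _ _ _ _ H L).
Qed.

Definition SetSub (p : nat) (U : fm) (a : nat) : fm :=
  Ex (SubCls (SetCls 0) (lift 1 1 U) && InI (S p) (SetCls 0) (S a)).

Lemma SetSub_intro G p U a v : G ⊢ SubCls (SetCls v) U -> G ⊢ InI p (SetCls v) a ->
  G ⊢ SetSub p U a.
Proof.
  intros H K. apply ExI with v. apply AndI; [|exact K].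
  unfold SubCls in *. gsimp. rewrite ren_ren. goal_id U. exact H.
Qed.

(** Compactness without a bound on the subsets. The elements derivable from some subset of U form a
    Φ-closed class, since Strong Collection and Union merge the subsets found for the premises. *)
Lemma InI_set_sub G p U a : G ⊢ InI p U a -> G ⊢ SetSub p U a.
Proof.
  set (R := SubCls (SetCls 0) (lift 1 2 U) && InI (2 + p) (SetCls 0) 1).
  assert (E : forall b, at1 (Ex R) b = SetSub p U b).
  { intros b. unfold R, SetSub, SubCls, at1. cbn [ren]. rewrite ren_InI.
    cbn. repeat f_equal. ren_solve. }
  intros H. rewrite <- E. apply (InI_ind _ _ _ _ _) with (3 := H); clear H.
  - apply Closed_intro. intros x b G' Hs Hx Hb. wk Hs.
    apply (collection _ _ _ _ Hb). intros m G' Hs H1 H2. wk Hs. clear Hb.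
    unfold R, SubCls in H1, H2. fs_in H1. fs_in H2.
    fxe (union_ex G m) u Hu. rewrite E. apply SetSub_intro with u.
    + apply SubCls_intro. intros c G' Hs Hc. wk Hs.
      pose proof (IsUnion_elim _ _ _ _ Hu Hc) as K. fx K v Hv.
      fbl H2 v Hv as L. fx L d Hd. fa L L1 L2. fal L1 c as M.
      fold_at U c M. exact (ImpE _ _ _ _ M K).
    + apply InI_step with x; [exact Hx|]. intros c G' Hs Hc. wk Hs.
      fbl H1 c Hc as K. fx K v Hv. fa K K1 K2. apply InI_mono with v; [|exact K2].
      fi d Hd. exact (IsUnion_intro _ _ _ _ _ Hu Hv Hd).
  - apply SubCls_intro. intros b G' Hs Hb. wk Hs. rewrite E.
    fxe (UPair_ex G b b) v Hv. apply SetSub_intro with v.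
    + apply SubCls_intro. intros c G' Hs Hc. wk Hs.
      pose proof (single_in _ _ _ _ Hv Hc) as K. now fsubst K.
    + apply InI_base. exact (UPair_l _ _ _ _ Hv).
Qed.
End Classes.

(** * Covers of the rules, labels and the set of trees *)

Definition IsW (w f a : nat) : fm := All (0 ∈ S w <--> WTree 0 (S f) (S a)).
(** The refinement property of AMC for surjections onto x. It is monotone in P, so that one set can
    serve all rules. *)
Definition CovX (P x : nat) : fm :=
  All (All (Surj 0 1 (2 + x) -->
    BEx (2 + P) (Ex (Ex (Surj 2 1 (5 + x) && Fun 0 1 4 && Factors 3 0 2))))).
Definition Cov (q p : nat) : fm := All (All (PairIn 1 0 (2 + p) --> CovX (2 + q) 1)).

(** The labels are the pairs (u, v) with u ∈ S ∪ {S} and v ∈ Q ∪ {∅}; a label is a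
    leaf if u ∈ S and an inner node if u = S. The branches at (u, v) are indexed by
    the elements of v. *)
Definition Labels (a b f s q : nat) : fm :=
  Fun f b a &&
  BAll a (Ex (Ex (OPair 2 1 0 && (1 ∈ (3 + s) || 1 == (3 + s))))) &&
  BAll s (BEx (S a) (Ex (OPair 1 2 0 && Empty 0))) &&
  BAll q (All (OPair 0 (2 + s) 1 --> 0 ∈ (2 + a))) &&
  BAll a (All (All (OPair 2 1 0 --> All (PairIn 0 3 (4 + f) <--> BEx 1 (OPair 1 4 0))))).

Lemma ren_IsW f x y z : ren f (IsW x y z) = IsW (f x) (f y) (f z).
Proof. reflexivity. Qed.
Lemma ren_CovX f x y : ren f (CovX x y) = CovX (f x) (f y).
Proof. reflexivity. Qed.
Lemma ren_Cov f x y : ren f (Cov x y) = Cov (f x) (f y).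
Proof. reflexivity. Qed.
Lemma ren_Labels f a b g s q : ren f (Labels a b g s q) = Labels (f a) (f b) (f g) (f s) (f q).
Proof. reflexivity. Qed.
#[local] Hint Rewrite ren_IsW ren_CovX ren_Cov ren_Labels : fm.

Section Trees.
Context {T : fm -> Prop} {HT : Theory T}.
Local Notation "G ⊢ A" := (prv T G A) (at level 70).

Lemma Fun_cod_mono G f a b b' : G ⊢ Fun f a b -> G ⊢ Sub b b' -> G ⊢ Fun f a b'.
Proof.
  intros H K. pose proof H as H'. fa H H1 H2 H3. apply AndI; [apply AndI|]; auto.
  fi z Hz. fbl H1 z Hz as L. fx L x Hx. fx L y Hy. fbx x; [exact Hx|].
  fbx y; [|exact L]. eapply sub_elim; eauto.
Qed.

Lemma Node_mono f a : monotone T (Node 0 (2 + f) (2 + a) 1).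
Proof.
  intros G t t' y Ht H. change (G ⊢ Node y f a t) in H. change (G ⊢ Node y f a t').
  fx H l Hl. fx H d. fx H g. fa H H1 H2 H3. fbx l; [exact Hl|]. fex d. fex g.
  fsplit; auto. eapply Fun_cod_mono; eauto.
Qed.

Lemma IsW_inv G w f a x : G ⊢ IsW w f a -> G ⊢ x ∈ w -> G ⊢ Node x f a w.
Proof.
  intros H Hx. pose proof (all_iff1 _ _ _ x H Hx) as K.
  change (G ⊢ GFP x (Node 0 (2 + f) (2 + a) 1)) in K.
  apply (GFP_elim _ _ _ _ K). intros t G' Hs Hxt Ht. wk Hs.
  apply (Node_mono f a G t w x); [|exact (Good_elim _ _ _ _ Ht Hxt)].
  fi y Hy. apply (all_iff2 _ _ _ y H).
  exact (GFP_intro _ _ _ _ Ht Hy).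
Qed.

Lemma IsW_intro G w f a x l d t : G ⊢ IsW w f a -> G ⊢ OPair x l t -> G ⊢ l ∈ a ->
  G ⊢ Fiber d f l -> G ⊢ Fun t d w -> G ⊢ x ∈ w.
Proof.
  intros H Hx Hl Hd Ht. apply (all_iff2 _ _ _ x H).
  change (G ⊢ GFP x (Node 0 (2 + f) (2 + a) 1)).
  (* Each tree in w comes with its own good set; m unites them, so that all subtrees given by t lie
     in one. *)
  pose proof (GFP_collect G w _ (Node_mono f a)) as K. lapply K; clear K; [intros K|].
  2:{ intros y G' Hs Hy. wk Hs. exact (all_iff1 _ _ _ y H Hy). }
  rx K m. fa K K1 K2. change (G ⊢ Sub w m) in K1.
  apply GFP_add with m; [apply Node_mono|exact K2|].
  change (G ⊢ Node x f a m). fbx l; [exact Hl|]. fex d. fex t. fsplit; auto.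
  eapply Fun_cod_mono; eauto.
Qed.

Lemma boxes_elim n G A x y : G ⊢ inst x (boxes (S n) A) -> G ⊢ y ∈ x -> G ⊢ inst y (boxes n A).
Proof. apply Box_elim. Qed.

Lemma IsW_ind G w f a P : G ⊢ IsW w f a ->
  (forall x l d t G', incl G G' -> G' ⊢ x ∈ w -> G' ⊢ l ∈ a -> G' ⊢ OPair x l t ->
    G' ⊢ Fiber d f l -> G' ⊢ Fun t d w ->
    (forall b v G'', incl G' G'' -> G'' ⊢ PairIn b v t -> G'' ⊢ at1 P v) ->
    G' ⊢ at1 P x) ->
  G ⊢ BAll w P.
Proof.
  (* For x = (l, t) and (b, v) ∈ t the descent is v ∈ m' ∈ (b, v) ∈ t ∈ m ∈ x, hence five boxes. *)
  intros H HP. apply (deep_induction 4). apply all_intro. intros x.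
  change (inst x (boxes 5 (0 ∈ S w --> P) --> (0 ∈ S w --> P)))
    with (inst x (boxes 5 (0 ∈ S w --> P)) --> (x ∈ w --> at1 P x)).
  apply imp_intro. intros G1 H1 IH. apply imp_intro. intros G2 H2 Hx.
  pose proof (prv_weak _ _ _ _ (incl_tran H1 H2) H) as HW.
  pose proof (IsW_inv _ _ _ _ _ HW Hx) as K.
  apply (bex_elim _ _ _ _ K). intros l G3 H3 Hl L. fs_in L.
  apply (ex_elim _ _ _ L). intros d G4 H4 M. fs_in M.
  apply (ex_elim _ _ _ M). intros t G5 H5 N. fs_in N. clear K L M.
  pose proof (incl_tran H1 (incl_tran H2 (incl_tran H3 (incl_tran H4 H5)))) as Hs.
  wk H2. wk H3. wk H4. wk H5. fa N N1 N2 N3.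
  apply (HP x l d t _ Hs); auto.
  intros b v G' Hs' Hbv. clear HP Hs. wk Hs'.
  pose proof (OPair_bound _ _ _ _ N1) as K. fx K m Hm. fa K _K K. clear _K.
  fx Hbv z Hz. pose proof (OPair_bound _ _ _ _ Hbv) as L. fx L m' Hm'. fa L _L L. clear _L.
  apply (boxes_elim 4) with (y := m) in IH; [|exact Hm].
  apply (boxes_elim 3) with (y := t) in IH; [|exact K].
  apply (boxes_elim 2) with (y := z) in IH; [|exact Hz].
  apply (boxes_elim 1) with (y := m') in IH; [|exact Hm'].
  apply (boxes_elim 0) with (y := v) in IH; [|exact L].
  eapply ImpE; [exact IH|].
  pose proof (PairIn_intro _ _ _ _ _ Hbv Hz) as R.
  pose proof (Fun_dom_cod _ _ _ _ _ _ N3 R) as S. fa S S1 S2. exact S2.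
Qed.

Lemma Fiber_ex G f b a l : G ⊢ Fun f b a -> G ⊢ Ex (Fiber 0 (S f) (S l)).
Proof.
  intros H. pose proof (separation_ex G b (PairIn 0 (S l) (S f))) as K.
  lapply K; clear K; [intros K|delta0]. fx K d. fex d. fi x. fsplit; fi L.
  - pose proof (all_iff1 _ _ _ x K L) as M. fa M M1 M2. exact M2.
  - apply (all_iff2 _ _ _ x K). apply AndI; [|exact L].
    pose proof (Fun_dom_cod _ _ _ _ _ _ H L) as M. fa M M1 M2. exact M1.
Qed.

(** A function with prescribed fibres is the first projection of a disjoint sum: b consists of the
    pairs (l, z) with l = (u, v) and z ∈ v, so the fibre over l is a copy of v. *)
Lemma Labels_ex G s q : G ⊢ Ex (Ex (Ex (Labels 2 1 0 (3 + s) (3 + q)))).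
Proof.
  fxe (Adj_ex G s s) s' Hs'. fxe (empty_ex G) o Ho. fxe (Adj_ex G q o) q' Hq'.
  (* The ∅ in q' is the second component of leaf labels and leaves them without branches. It
     contributes no indices, so e = ⋃Q bounds them all. *)
  fxe (Prod_ex G s' q') a Ha. fxe (union_ex G q) e He.
  apply (Rel_ex G a e (BEx (2 + s') (BEx (3 + q') (OPair 3 1 0 && 2 ∈ 0)))); [delta0|].
  intros b G' Hs Hb. wk Hs.
  apply (Rel_ex G b a (BEx (2 + e) (OPair 2 1 0))); [delta0|].
  intros f G' Hs Hf. wk Hs.
  fex a. fex b. fex f. unfold Labels. fsplit.
  - apply (Rel_Fun _ _ _ _ _ Hf).
    + fi x Hx. pose proof (Rel_elem _ _ _ _ _ _ Hb Hx) as K. fx K l Hl. fx K z Hz.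
      fa K K1 K2. fbx l; [exact Hl|]. fbx z; [exact Hz|]. exact K1.
    + fi x. fi l. fi l'. fi K. fi L.
      pose proof (Rel_elim _ _ _ _ _ _ _ Hf K) as K'. fa K' _k1 _k2 K'. fs_in K'. fx K' z Hz.
      pose proof (Rel_elim _ _ _ _ _ _ _ Hf L) as L'. fa L' _l1 _l2 L'. fs_in L'. fx L' z' Hz'.
      pose proof (OPair_inj _ _ _ _ _ _ K' L') as E. now fa E E1 E2.
  - fi l Hl. pose proof (Prod_elim _ _ _ _ _ Ha Hl) as K. fx K u Hu. fx K v Hv.
    fex u. fex v. apply AndI; [exact K|]. exact (Adj_in _ _ _ _ _ Hs' Hu).
  - fi u Hu. fxe (OPair_ex G u o) l Hl. fbx l.
    + apply (Prod_intro _ _ _ _ _ _ _ Ha) with (3 := Hl).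
      * exact (Adj_old _ _ _ _ _ Hs' Hu).
      * exact (Adj_new _ _ _ _ Hq').
    + fex o. now apply AndI.
  - fi v Hv. fi l. fi Hl. apply (Prod_intro _ _ _ _ _ _ _ Ha) with (3 := Hl).
    + exact (Adj_new _ _ _ _ Hs').
    + exact (Adj_old _ _ _ _ _ Hq' Hv).
  - fi l Hl. fi u. fi v. fi Huv. fi x. fsplit; fi K.
    + pose proof (Rel_elim _ _ _ _ _ _ _ Hf K) as L. fa L L1 L2 L3. fs_in L3. fx L3 z Hz.
      pose proof (Rel_elem _ _ _ _ _ _ Hb L1) as M. fx M l' Hl'. fx M z' Hz'.
      fa M M1 M2. pose proof (OPair_inj _ _ _ _ _ _ M1 L3) as E. fa E E1 E2.
      fsubst E1. fsubst E2. fx M2 u' Hu'. fx M2 v' Hv'. fa M2 M2 M3.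
      pose proof (OPair_inj _ _ _ _ _ _ M2 Huv) as E. fa E E1 E2. fsubst E2.
      fbx z; assumption.
    + fx K z Hz.
      pose proof (Prod_elim _ _ _ _ _ Ha Hl) as L. fx L u' Hu. fx L v' Hv.
      pose proof (OPair_inj _ _ _ _ _ _ L Huv) as E. fa E E1 E2. fsubst E1. fsubst E2.
      assert (He' : G ⊢ z ∈ e).
      { pose proof (Adj_in _ _ _ _ _ Hq' Hv) as M. fo M.
        - exact (IsUnion_intro _ _ _ _ _ He M Hz).
        - fsubst M. apply BotE. now fbl Ho z Hz as N. }
      assert (Hx : G ⊢ x ∈ b).
      { apply (PairIn_elem _ l z _ _ K). apply (Rel_intro _ _ _ _ _ _ _ Hb Hl He').
        fs. fbx u; [exact Hu|]. fbx v; [exact Hv|]. now apply AndI. }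
      apply (Rel_intro _ _ _ _ _ _ _ Hf Hx Hl). fs. fbx z; assumption.
Qed.

Lemma Cov_elim G q p x a y g : G ⊢ Cov q p -> G ⊢ PairIn x a p -> G ⊢ Surj g y x ->
  G ⊢ BEx q (Ex (Ex (Surj 2 1 (3 + x) && Fun 0 1 (3 + y) && Factors (3 + g) 0 2))).
Proof.
  intros H K L. fal H x as M. fal M a as N. pose proof (ImpE _ _ _ _ N K) as P.
  fal P y as Q. fal Q g as R. exact (ImpE _ _ _ _ R L).
Qed.
End Trees.

(** * The uses of WS and AMC *)

Section Choice.
Local Notation "G ⊢ A" := (prv CZF_WS_AMC G A) (at level 70).

Lemma IsW_ex G f b a : G ⊢ Fun f b a -> G ⊢ Ex (IsW 0 (S f) (S a)).
Proof.
  intros H. assert (K : G ⊢ WS) by apply Ax, of_WS.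
  fal K f as K1. fal K1 b as K2. fal K2 a as K3. exact (ImpE _ _ _ _ K3 H).
Qed.

Lemma Cov_ex G s p : G ⊢ IndDef s p -> G ⊢ Ex (Cov 0 (S p)).
Proof.
  intros H.
  assert (K : G ⊢ BAll p (Ex (All (All (OPair 3 1 0 --> CovX 2 1))))).
  { fi y Hy. fbl H y Hy as K. fx K x. fx K a. fa K K1 K2 K3.
    assert (L : G ⊢ AMC) by apply Ax, of_AMC.
    fal L x as M. fx M P. fa M M1 M2. fex P. fi x'. fi a'. fi N.
    pose proof (OPair_inj _ _ _ _ _ _ N K1) as E. fa E E1 E2. fsubst E1. exact M2. }
  (* AMC covers one premise set X at a time; by monotonicity of [CovX] the union of the collected
     sets covers them all. *)
  apply collection_ex in K. fx K M. fa K K1 K2. fxe (union_ex G M) q Hq.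
  fex q. fi x. fi a. fi Hxa. fx Hxa y Hy. fbl K1 y Hy as L. fx L P HP.
  fal L x as L1. fal L1 a as L2. pose proof (ImpE _ _ _ _ L2 Hxa) as L3.
  fi z. fi g. fi Hg. fal L3 z as L4. fal L4 g as L5. pose proof (ImpE _ _ _ _ L5 Hg) as L6.
  fx L6 h Hh. fbx h; [|exact L6]. exact (IsUnion_intro _ _ _ _ _ Hq HP Hh).
Qed.
End Choice.

(** Der s p u w a: the tree w is a derivation of a from the leaves in u. *)
Definition LeafD (u l a : nat) : fm := Ex (OPair (S l) (S a) 0) && a ∈ u.
(** The label is (S, q) with q : Z ↠ X and (X, a) ∈ Φ. Branches are indexed by the graph of q: the
    branch at e = (z, x) must carry a derivation of x, so the premise is read off the branch. The
    set k holds pairs of a tree and its conclusion. *)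
Definition NodeD (s p l a t k : nat) : fm :=
  Ex (Ex (Ex (OPair (3 + l) (3 + s) 0 && PairIn 2 (3 + a) (3 + p) && Surj 0 1 2 &&
    BAll 0 (Ex (Ex (Ex (Ex (OPair 4 3 2 && OPair 1 (8 + l) 4 && PairIn 1 0 (8 + t) &&
      PairIn 0 2 (8 + k))))))))).
Definition StepDAt (s p u y k : nat) : fm :=
  Ex (Ex (Ex (Ex (OPair (4 + y) 3 2 && OPair 3 1 0 &&
    (LeafD (4 + u) 1 2 || NodeD (4 + s) (4 + p) 1 2 0 (4 + k)))))).
Definition StepD (s p u : nat) : fm := StepDAt (2 + s) (2 + p) (2 + u) 0 1.
Definition DerP (s p u y : nat) : fm := GFP y (StepD s p u).
Definition Der (s p u w a : nat) : fm :=
  Ex (OPair 0 (S w) (S a) && DerP (S s) (S p) (S u) 0).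
Definition NodeDer (s p u l a t : nat) : fm :=
  Ex (Ex (Ex (OPair (3 + l) (3 + s) 0 && PairIn 2 (3 + a) (3 + p) && Surj 0 1 2 &&
    BAll 0 (Ex (Ex (Ex (Ex (OPair 4 3 2 && OPair 1 (8 + l) 4 && PairIn 1 0 (8 + t) &&
      Der (8 + s) (8 + p) (8 + u) 0 2)))))))).

(** Value s p w k: k = (V, C) where V is the set of leaves of w, and C contains the
    root of w whenever w is a derivation. *)
Definition Value (s p w k : nat) : fm :=
  Ex (Ex (OPair (2 + k) 1 0 && Sub 1 (2 + s) && BAll 0 (InI (3 + p) (SetCls 2) 0) &&
    All (All (Sub 1 (4 + s) --> Der (4 + s) (4 + p) 1 (4 + w) 0 --> Sub 3 1 && 0 ∈ 2)))).
(** The components of a pair k are elements of an element of k, which keeps this formula and the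
    next bounded for Separation. *)
Definition FstMem (x k : nat) : fm := BEx k (BEx 0 (BEx 1 (OPair (3 + k) 1 0 && (3 + x) ∈ 1))).
Definition SndMem (x k : nat) : fm := BEx k (BEx 0 (BEx 1 (OPair (3 + k) 1 0 && (3 + x) ∈ 0))).

Lemma ren_LeafD f u l a : ren f (LeafD u l a) = LeafD (f u) (f l) (f a).
Proof. reflexivity. Qed.
Lemma ren_NodeD f s p l a t k :
  ren f (NodeD s p l a t k) = NodeD (f s) (f p) (f l) (f a) (f t) (f k).
Proof. reflexivity. Qed.
Lemma ren_NodeDer f s p l a t k :
  ren f (NodeDer s p l a t k) = NodeDer (f s) (f p) (f l) (f a) (f t) (f k).
Proof. reflexivity. Qed.
Lemma ren_DerP f s p u y : ren f (DerP s p u y) = DerP (f s) (f p) (f u) (f y).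
Proof. reflexivity. Qed.
Lemma ren_Der f s p u w a : ren f (Der s p u w a) = Der (f s) (f p) (f u) (f w) (f a).
Proof. reflexivity. Qed.
Lemma ren_Value f s p w k : ren f (Value s p w k) = Value (f s) (f p) (f w) (f k).
Proof. reflexivity. Qed.
Lemma ren_FstMem f x k : ren f (FstMem x k) = FstMem (f x) (f k).
Proof. reflexivity. Qed.
Lemma ren_SndMem f x k : ren f (SndMem x k) = SndMem (f x) (f k).
Proof. reflexivity. Qed.
#[local] Hint Rewrite ren_LeafD ren_NodeD ren_NodeDer ren_DerP ren_Der ren_Value
  ren_FstMem ren_SndMem : fm.

Section Derivations.
Context {T : fm -> Prop} {HT : Theory T}.
Local Notation "G ⊢ A" := (prv T G A) (at level 70).

Lemma delta0_FstMem x k : delta0 (T := T) (FstMem x k).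
Proof. unfold FstMem. delta0. Qed.
Lemma delta0_SndMem x k : delta0 (T := T) (SndMem x k).
Proof. unfold SndMem. delta0. Qed.

Lemma FstMem_intro G x k v c : G ⊢ OPair k v c -> G ⊢ x ∈ v -> G ⊢ FstMem x k.
Proof.
  intros H Hx. pose proof (OPair_bound _ _ _ _ H) as K. fx K m Hm. fa K K1 K2.
  fbx m; auto. fbx v; auto. fbx c; auto. now apply AndI.
Qed.
Lemma SndMem_intro G x k v c : G ⊢ OPair k v c -> G ⊢ x ∈ c -> G ⊢ SndMem x k.
Proof.
  intros H Hx. pose proof (OPair_bound _ _ _ _ H) as K. fx K m Hm. fa K K1 K2.
  fbx m; auto. fbx v; auto. fbx c; auto. now apply AndI.
Qed.
Lemma FstMem_elim G x k v c : G ⊢ OPair k v c -> G ⊢ FstMem x k -> G ⊢ x ∈ v.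
Proof.
  intros H K. fx K m Hm. fx K v' Hv. fx K c' Hc. fa K K1 K2.
  pose proof (OPair_inj _ _ _ _ _ _ K1 H) as E. fa E E1 E2. now fsubst E1.
Qed.
Lemma SndMem_elim G x k v c : G ⊢ OPair k v c -> G ⊢ SndMem x k -> G ⊢ x ∈ c.
Proof.
  intros H K. fx K m Hm. fx K v' Hv. fx K c' Hc. fa K K1 K2.
  pose proof (OPair_inj _ _ _ _ _ _ K1 H) as E. fa E E1 E2. now fsubst E2.
Qed.

Lemma NodeD_mono G s p l a t k k' : G ⊢ Sub k k' -> G ⊢ NodeD s p l a t k ->
  G ⊢ NodeD s p l a t k'.
Proof.
  intros H K. fx K x. fx K z. fx K q. fa K K1 K2 K3 K4. fex x. fex z. fex q.
  fsplit; auto. fi e He. fbl K4 e He as L. fx L e1. fx L e2. fx L b. fx L v.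
  fa L L1 L2 L3 L4. fex e1. fex e2. fex b. fex v. fsplit; auto.
  eapply PairIn_sub; eauto.
Qed.

Lemma StepD_mono s p u : monotone T (StepD s p u).
Proof.
  intros G k k' y H K. change (G ⊢ StepDAt s p u y k) in K.
  change (G ⊢ StepDAt s p u y k'). fx K w. fx K a. fx K l. fx K t. fa K K1 K2 K3.
  fex w. fex a. fex l. fex t. fsplit; auto. fo K3; [now apply OrI1|].
  apply OrI2. eapply NodeD_mono; eauto.
Qed.

Lemma Der_inv G s p u w a l t : G ⊢ Der s p u w a -> G ⊢ OPair w l t ->
  G ⊢ LeafD u l a || NodeDer s p u l a t.
Proof.
  intros H Hw. fx H y. fa H H1 H2. apply (GFP_elim _ _ _ _ H2). intros k G' Hs Hy Hk.
  wk Hs. pose proof (Good_elim _ _ _ _ Hk Hy) as K. change (G ⊢ StepDAt s p u y k) in K.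
  fx K w'. fx K a'. fx K l'. fx K t'. fa K K1 K2 K3.
  pose proof (OPair_inj _ _ _ _ _ _ K1 H1) as E. fa E E1 E2. fsubst E1. fsubst E2.
  pose proof (OPair_inj _ _ _ _ _ _ K2 Hw) as E. fa E E1 E2. fsubst E1. fsubst E2.
  fo K3; [now apply OrI1|]. apply OrI2.
  fx K3 x. fx K3 z. fx K3 q. fa K3 L1 L2 L3 L4. fex x. fex z. fex q. fsplit; auto.
  fi e He. fbl L4 e He as L. fx L e1. fx L e2. fx L b. fx L v.
  fa L M1 M2 M3 M4. fex e1. fex e2. fex b. fex v. fsplit; auto.
  fx M4 c Hc. fex c. fsplit; auto. apply GFP_intro with k; [exact Hk|exact Hc].
Qed.

Lemma Der_leaf G s p u w a l t v : G ⊢ OPair w l t -> G ⊢ OPair l a v -> G ⊢ a ∈ u ->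
  G ⊢ Der s p u w a.
Proof.
  intros Hw Hl Ha. fxe (empty_ex G) o Ho. fxe (OPair_ex G w a) y Hy.
  fex y. apply AndI; [exact Hy|]. apply GFP_add with o; [apply StepD_mono| |].
  - apply Good_intro. intros z G' Hs Hz. wk Hs. apply BotE. now fbl Ho z Hz as K.
  - change (G ⊢ StepDAt s p u y o). fex w. fex a. fex l. fex t. fsplit; auto.
    apply OrI1. apply AndI; [now fex v|exact Ha].
Qed.

Lemma Der_node G s p u w a l t x z q m : G ⊢ OPair w l t -> G ⊢ OPair l s q ->
  G ⊢ PairIn x a p -> G ⊢ Surj q z x ->
  G ⊢ BAll m (DerP (S s) (S p) (S u) 0) -> G ⊢ NodeD s p l a t m ->
  G ⊢ Der s p u w a.
Proof.
  intros Hw Hl Ha Hq Hm HN. fxe (OPair_ex G w a) y Hy. fex y. apply AndI; [exact Hy|].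
  pose proof (GFP_collect G m _ (StepD_mono s p u)) as K. lapply K; clear K; [intros K|].
  2:{ intros c G' Hs Hc. wk Hs. now fbl Hm c Hc as L. }
  rx K k. fa K K1 K2. change (G ⊢ Sub m k) in K1. change (G ⊢ Good k (StepD s p u)) in K2.
  apply GFP_add with k; [apply StepD_mono|exact K2|].
  change (G ⊢ StepDAt s p u y k). fex w. fex a. fex l. fex t. fsplit; auto.
  apply OrI2. eapply NodeD_mono; eauto.
Qed.

(** ** Every tree has a set of leaves *)

Lemma Value_leaf G s p w l t v x : G ⊢ OPair w l t -> G ⊢ OPair l x v -> G ⊢ x ∈ s ->
  G ⊢ Ex (Value (S s) (S p) (S w) 0).
Proof.
  intros Hw Hl Hx. fxe (UPair_ex G x x) V HV. fxe (OPair_ex G V V) k Hk.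
  fex k. fex V. fex V. fsplit.
  - exact Hk.
  - fi y Hy. pose proof (single_in _ _ _ _ HV Hy) as E. now fsubst E.
  - fi c Hc. now apply InI_base.
  - fi u. fi a. fi Hu. fi H. pose proof (Der_inv _ _ _ _ _ _ _ _ H Hw) as K. fo K.
    + fa K K1 K2. fx K1 v'. pose proof (OPair_inj _ _ _ _ _ _ K1 Hl) as E. fa E E1 E2.
      fsubst E1. fsplit; [|exact (UPair_l _ _ _ _ HV)].
      fi y Hy. pose proof (single_in _ _ _ _ HV Hy) as E. now fsubst E.
    (* A derivation by an inner node would force x = S, hence S ∈ S. *)
    + apply BotE. fx K X. fx K Z. fx K q. fa K K1 K2 K3 K4.
      pose proof (OPair_inj _ _ _ _ _ _ K1 Hl) as E. fa E E1 E2. fsubst E1.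
      now apply mem_irrefl in Hx.
Qed.

(** V and D unite the leaves and the conclusions of the subtrees, and C takes the conclusions of all
    rules with premises in D. Soundness passes upwards because V contains the leaf set of each
    subtree. *)
Lemma Value_node G s p w l t v a b f q d W : G ⊢ IndDef s p -> G ⊢ Labels a b f s q ->
  G ⊢ l ∈ a -> G ⊢ OPair w l t -> G ⊢ OPair l s v -> G ⊢ Fiber d f l -> G ⊢ Fun t d W ->
  G ⊢ All (All (PairIn 1 0 (2 + t) --> Ex (Value (3 + s) (3 + p) 1 0))) ->
  G ⊢ Ex (Value (S s) (S p) (S w) 0).
Proof.
  intros Hp HL Hla Hw Hl Hd Ht IH.
  (* Values are not unique, so M gathers some for every subtree, each tied to a branch. *)
  assert (K : G ⊢ BAll t (Ex (Ex (Ex (OPair 3 1 0 && Value (4 + s) (4 + p) 0 2))))).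
  { fi y Hy. pose proof (Fun_elem _ _ _ _ _ Ht Hy) as K. fx K c Hc. fx K x Hx.
    fal IH c as L. fal L x as M.
    pose proof (ImpE _ _ _ _ M (PairIn_intro _ _ _ _ _ K Hy)) as N. fx N k.
    fex k. fex c. fex x. now apply AndI. }
  apply collection_ex in K. fx K M. fa K K1 K2.
  pose proof (separation_ex G s (BEx (S M) (FstMem 1 0))) as S1.
  lapply S1; [clear S1; intros S1|apply delta0_BEx, delta0_FstMem]. fx S1 V.
  pose proof (separation_ex G s (BEx (S M) (SndMem 1 0))) as S2.
  lapply S2; [clear S2; intros S2|apply delta0_BEx, delta0_SndMem]. fx S2 D.
  (* The premise set X is an element of an element of the rule y ∈ Φ, so the formula is bounded. *)
  pose proof (separation_ex G s
    (BEx (S p) (BEx 0 (BEx 0 (OPair 2 0 3 && Sub 0 (4 + D)))))) as S3.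
  lapply S3; [clear S3; intros S3|delta0]. fx S3 C.
  fxe (OPair_ex G V C) k Hk. fex k. fex V. fex C. fsplit.
  - exact Hk.
  - fi x Hx. pose proof (all_iff1 _ _ _ x S1 Hx) as L. now fa L L1 L2.
  - fi c Hc. pose proof (all_iff1 _ _ _ c S3 Hc) as L. fa L L1 L2. fs_in L2.
    fx L2 y Hy. fx L2 m Hm. fx L2 X HX. fa L2 L2 L3.
    apply InI_step with X; [exact (PairIn_intro _ _ _ _ _ L2 Hy)|].
    intros x G' Hs Hx. wk Hs. pose proof (sub_elim _ _ _ _ L3 Hx) as N.
    pose proof (all_iff1 _ _ _ x S2 N) as P. fa P P1 P2. fs_in P2. fx P2 j Hj.
    fbl K2 j Hj as R. fx R y' Hy'. fx R c'. fx R x'. fa R R1 R2.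
    fx R2 V'. fx R2 C'. fa R2 Q1 Q2 Q3 Q4.
    pose proof (SndMem_elim _ _ _ _ _ Q1 P2) as Hx'. fbl Q3 x Hx' as Q5.
    apply InI_mono with V'; [|exact Q5].
    fi z Hz. apply (all_iff2 _ _ _ z S1). fs. apply AndI; [eapply sub_elim; eauto|].
    fbx j; [exact Hj|]. eapply FstMem_intro; eauto.
  - fi u. fi c. fi Hu. fi H. pose proof (Der_inv _ _ _ _ _ _ _ _ H Hw) as K. fo K.
    { apply BotE. fa K N1 N2. fx N1 v'. pose proof (OPair_inj _ _ _ _ _ _ N1 Hl) as E.
      fa E E1 E2. fsubst E1. pose proof (sub_elim _ _ _ _ Hu N2) as N3.
      now apply mem_irrefl in N3. }
    fx K X. fx K Z. fx K g. fa K N1 N2 N3 N4.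
    pose proof (OPair_inj _ _ _ _ _ _ N1 Hl) as E. fa E _E E. clear _E. fsubst E.
    fsplit.
    (* A leaf x comes from the subtree on some branch. By the description of the fibres that branch
       is (l, e) with e in the surjection, so the derivation makes this very subtree a derivation
       from u. *)
    + fi x Hx. pose proof (all_iff1 _ _ _ x S1 Hx) as L. fa L L1 L2. fs_in L2.
      fx L2 j Hj. fbl K2 j Hj as R. fx R y Hy. fx R b'. fx R x'. fa R R1 R2.
      pose proof (PairIn_intro _ _ _ _ _ R1 Hy) as P.
      pose proof (Fun_dom_cod _ _ _ _ _ _ Ht P) as P1. fa P1 P1 P2.
      pose proof (all_iff1 _ _ _ b' Hd P1) as P3.
      fa HL F1 F2 F3 F4 F5. fbl F5 l Hla as F6. fal F6 s as F7. fal F7 v as F8.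
      pose proof (ImpE _ _ _ _ F8 Hl) as F9. pose proof (all_iff1 _ _ _ b' F9 P3) as F10.
      fs_in F10. fx F10 e He. fbl N4 e He as A.
      fx A e1. fx A e2. fx A b2. fx A x2. fa A A1 A2 A3 A4.
      pose proof (OPair_unique _ _ _ _ _ A2 F10) as E. fsubst E.
      pose proof (Fun_eq _ _ _ _ _ _ _ Ht A3 P) as E. fsubst E.
      fx R2 V'. fx R2 C'. fa R2 Q1 Q2 Q3 Q4. fal Q4 u as Q5. fal Q5 e2 as Q6.
      pose proof (ImpE _ _ _ _ (ImpE _ _ _ _ Q6 Hu) A4) as Q7. fa Q7 Q8 Q9.
      apply (sub_elim _ _ _ _ Q8). eapply FstMem_elim; eauto.
    + apply (all_iff2 _ _ _ c S3). fs.
      pose proof (PairIn_IndDef _ _ _ _ _ Hp N2) as HI. fa HI HI1 HI2.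
      apply AndI; [exact HI2|]. fx N2 y Hy.
      pose proof (OPair_bound _ _ _ _ N2) as B. fx B m Hm. fa B B1 B2.
      fbx y; [exact Hy|]. fbx m; [exact Hm|]. fbx X; [exact B1|].
      apply AndI; [exact N2|]. fi x Hx.
      apply (all_iff2 _ _ _ x S2). fs. apply AndI; [eapply sub_elim; eauto|].
      (* Surjectivity supplies a branch (z, x) for each premise x; its subtree derives x, so x lies
         in D. *)
      pose proof (Surj_onto _ _ _ _ _ N3 Hx) as A. fx A z Hz. fx A e He.
      fbl N4 e He as A'. fx A' e1. fx A' e2. fx A' b2. fx A' x2. fa A' A1 A2 A3 A4.
      pose proof (OPair_inj _ _ _ _ _ _ A1 A) as E. fa E E1 E2. fsubst E2.
      fx A3 y' Hy'. fbl K1 y' Hy' as R. fx R j Hj. fx R b3. fx R x3. fa R R1 R2.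
      pose proof (OPair_inj _ _ _ _ _ _ R1 A3) as E. fa E E3 E4. fsubst E4.
      fbx j; [exact Hj|].
      fx R2 V'. fx R2 C'. fa R2 Q1 Q2 Q3 Q4. fal Q4 u as Q5. fal Q5 x as Q6.
      pose proof (ImpE _ _ _ _ (ImpE _ _ _ _ Q6 Hu) A4) as Q7. fa Q7 Q8 Q9.
      eapply SndMem_intro; eauto.
Qed.

Lemma Value_total G s p a b f q W : G ⊢ IndDef s p -> G ⊢ Labels a b f s q ->
  G ⊢ IsW W f a -> G ⊢ BAll W (Ex (Value (2 + s) (2 + p) 1 0)).
Proof.
  intros Hp HL HW. apply (IsW_ind _ _ _ _ _ HW).
  intros w l d t G' Hs Hw Hl Hwl Hd Ht IH. wk Hs.
  change (G ⊢ Ex (Value (S s) (S p) (S w) 0)).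
  assert (IH' : G ⊢ All (All (PairIn 1 0 (2 + t) --> Ex (Value (3 + s) (3 + p) 1 0)))).
  { apply all_intro. intros c. apply all_intro. intros v. apply imp_intro.
    intros G1 Hs H. exact (IH c v G1 Hs H). }
  clear IH. pose proof HL as HL'. fa HL' F1 F2 F3 F4 F5.
  fbl F2 l Hl as K. fx K x. fx K v. fa K K1 K2. fo K2.
  - eapply Value_leaf; eauto.
  - fsubst K2. eapply Value_node; eauto.
Qed.

(** ** Every element of I(Φ,U) is derived by a tree *)

Lemma Der_complete G s p a b f q W u c : G ⊢ IndDef s p -> G ⊢ Labels a b f s q ->
  G ⊢ IsW W f a -> G ⊢ Cov q p -> G ⊢ Sub u s -> G ⊢ InI p (SetCls u) c ->
  G ⊢ BEx W (Der (S s) (S p) (S u) 0 (S c)).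
Proof.
  intros Hp HL HW HQ Hu Hc. fa HL F1 F2 F3 F4 F5.
  apply (InI_ind G p (SetCls u) (BEx (S W) (Der (2 + s) (2 + p) (2 + u) 0 1)) c);
    [clear c Hc|clear c Hc|exact Hc].
  2:{ apply SubCls_intro. intros c G' Hs Hc. wk Hs. change (G ⊢ c ∈ u) in Hc.
    change (G ⊢ BEx W (Der (S s) (S p) (S u) 0 (S c))).
    pose proof (sub_elim _ _ _ _ Hu Hc) as Hcs. fbl F3 c Hcs as K. fx K l Hl. fx K v.
    (* The leaf for c is ((c, ∅), ∅): the fibre over its label is empty, and the empty set is the
       function giving its subtrees. *)
    fa K K1 K2. fxe (empty_ex G) o Ho. fxe (OPair_ex G l o) w Hw.
    fxe (Fiber_ex G f b a l F1) d Hd. fbx w.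
    - apply (IsW_intro _ _ _ _ _ _ _ _ HW Hw Hl Hd). apply AndI; [apply AndI|].
      + fi y Hy. apply BotE. now fbl Ho y Hy as N.
      + fi y Hy. apply BotE. pose proof (all_iff1 _ _ _ y Hd Hy) as N. fs_in N.
        fbl F5 l Hl as N1. fal N1 c as N2. fal N2 v as N3.
        pose proof (ImpE _ _ _ _ N3 K1) as N4.
        pose proof (all_iff1 _ _ _ y N4 N) as N5. fs_in N5. fx N5 e He.
        now fbl K2 e He as N6.
      + fi y. fi z. fi z'. fi N. apply BotE. fx N e He. now fbl Ho e He as N'.
    - eapply Der_leaf; eauto. }
  apply Closed_intro. intros X c G' Hs HX Hc. wk Hs.
  change (G ⊢ BEx W (Der (S s) (S p) (S u) 0 (S c))).
  assert (K : G ⊢ BAll X (Ex (BEx (2 + W) (OPair 1 0 2) &&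
                              DerP (2 + s) (2 + p) (2 + u) 0))).
  { fi x Hx. fbl Hc x Hx as K. fx K w Hw. fx K y. fa K K1 K2. fex y. fsplit; [|exact K2].
    fbx w; [exact Hw|exact K1]. }
  clear Hc. apply collection_ex in K. fx K Y. fa K K1 K2.
  (* g is the projection (w, x) ↦ x; Y may hold several derivations of the same premise. *)
  apply (Rel_ex G Y X (BEx (2 + W) (OPair 2 0 1))); [delta0|].
  intros g G' Hs Hg. wk Hs.
  assert (Sg : G ⊢ Surj g Y X).
  { apply AndI; [apply (Rel_Fun _ _ _ _ _ Hg)|].
    - fi y Hy. fbl K2 y Hy as L. fx L x Hx. fa L L1 L2. fbx x; [exact Hx|].
      fx L1 w Hw. fbx w; [exact Hw|exact L1].
    - fi y. fi x. fi x'. fi L. fi M.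
      pose proof (Rel_elim _ _ _ _ _ _ _ Hg L) as L'. fa L' _1 _2 L'. fs_in L'. fx L' w Hw.
      pose proof (Rel_elim _ _ _ _ _ _ _ Hg M) as M'. fa M' _3 _4 M'. fs_in M'. fx M' w' Hw'.
      pose proof (OPair_inj _ _ _ _ _ _ L' M') as E. now fa E E1 E2.
    - fi x Hx. fbl K1 x Hx as L. fx L y Hy. fa L L1 L2. fbx y; [exact Hy|].
      apply (Rel_intro _ _ _ _ _ _ _ Hg Hy Hx). fs. fx L1 w Hw. fbx w; [exact Hw|exact L1]. }
  pose proof (Cov_elim _ _ _ _ _ _ _ HQ HX Sg) as L. fx L q' Hq'. fx L Z. fx L h.
  fa L Sq Fh Fa.
  (* For a branch e = (z, x), h(z) is a pair (w, x') in Y, and x' = x because g ∘ h = q'. So h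
     singles out a tree deriving x. *)
  assert (KF : G ⊢ BAll q' (BEx (S Z) (BEx (2 + X) (BEx (3 + Y) (BEx (4 + W)
    (OPair 4 3 2 && PairIn 3 1 (5 + h) && OPair 1 0 2)))))).
  { fi e He. pose proof (Fun_elem _ _ _ _ _ (Surj_Fun _ _ _ _ Sq) He) as L.
    fx L z Hz. fx L x Hx. pose proof (Fun_total _ _ _ _ _ Fh Hz) as M. fx M y.
    pose proof (Fun_dom_cod _ _ _ _ _ _ Fh M) as N. fa N _N Hy. clear _N.
    fbl K2 y Hy as P. fx P x' Hx'. fa P P1 P2. fx P1 w Hw.
    assert (R : G ⊢ PairIn y x' g).
    { apply (Rel_intro _ _ _ _ _ _ _ Hg Hy Hx'). fs. fbx w; [exact Hw|exact P1]. }
    fal Fa z as A1. fal A1 y as A2. fal A2 x' as A3.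
    pose proof (ImpE _ _ _ _ (ImpE _ _ _ _ A3 M) R) as A4.
    pose proof (Fun_eq _ _ _ _ _ _ _ (Surj_Fun _ _ _ _ Sq) A4
      (PairIn_intro _ _ _ _ _ L He)) as E. fsubst E.
    fbx z; [exact Hz|]. fbx x; [exact Hx|]. fbx y; [exact Hy|]. fbx w; [exact Hw|].
    fsplit; assumption. }
  fxe (OPair_ex G s q') l Hl.
  fbl F4 q' Hq' as L. fal L l as L'. pose proof (ImpE _ _ _ _ L' Hl) as Hla. clear L L'.
  fbl F5 l Hla as L. fal L s as L'. fal L' q' as M. pose proof (ImpE _ _ _ _ M Hl) as HB.
  clear L L' M. fxe (Fiber_ex G f b a l F1) d Hd.
  (* t sends the branch (l, e) to the tree that h singles out; it is single-valued because h is. *)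
  apply (Rel_ex G d W (BEx (2 + q') (BEx (3 + Z) (BEx (4 + X) (BEx (5 + Y)
    (OPair 5 (6 + l) 3 && OPair 3 2 1 && PairIn 2 0 (6 + h) && OPair 0 4 1)))))); [delta0|].
  intros t G' Hs Ht. wk Hs.
  assert (Ft : G ⊢ Fun t d W).
  { apply (Rel_Fun _ _ _ _ _ Ht).
    - fi i Hi. pose proof (all_iff1 _ _ _ i Hd Hi) as N. fs_in N.
      pose proof (all_iff1 _ _ _ i HB N) as N'. fs_in N'. fx N' e He.
      fbl KF e He as L. fx L z Hz. fx L x Hx. fx L y Hy. fx L w Hw. fa L L1 L2 L3.
      fbx w; [exact Hw|]. fbx e; [exact He|]. fbx z; [exact Hz|]. fbx x; [exact Hx|].
      fbx y; [exact Hy|]. fsplit; assumption.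
    - fi i. fi w. fi w'. fi L. fi M.
      pose proof (Rel_elim _ _ _ _ _ _ _ Ht L) as L'. fa L' _1 _2 L'. fs_in L'.
      fx L' e He. fx L' z Hz. fx L' x Hx. fx L' y Hy. fa L' A1 A2 A3 A4.
      pose proof (Rel_elim _ _ _ _ _ _ _ Ht M) as M'. fa M' _3 _4 M'. fs_in M'.
      fx M' e' He'. fx M' z' Hz'. fx M' x' Hx'. fx M' y' Hy'. fa M' B1 B2 B3 B4.
      pose proof (OPair_inj _ _ _ _ _ _ B1 A1) as E. fa E _5 E. fsubst E.
      pose proof (OPair_inj _ _ _ _ _ _ B2 A2) as E. fa E E1 E2. fsubst E1. fsubst E2.
      pose proof (Fun_eq _ _ _ _ _ _ _ Fh B3 A3) as E. fsubst E.
      pose proof (OPair_inj _ _ _ _ _ _ A4 B4) as E. now fa E E1 E2. }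
  fxe (OPair_ex G l t) w Hw. fbx w; [exact (IsW_intro _ _ _ _ _ _ _ _ HW Hw Hla Hd Ft)|].
  apply (Der_node _ _ _ _ _ _ _ _ X Z q' Y Hw Hl HX Sq).
  - fi y Hy. fbl K2 y Hy as L. fx L x Hx. now fa L L1 L2.
  - fex X. fex Z. fex q'. fsplit; auto. fi e He.
    fbl KF e He as L. fx L z Hz. fx L x Hx. fx L y Hy. fx L v Hv. fa L L1 L2 L3.
    fxe (OPair_ex G l e) i Hi. fex z. fex x. fex i. fex v. fsplit; auto.
    + assert (Hid : G ⊢ i ∈ d).
      { apply (all_iff2 _ _ _ i Hd). fs. apply (all_iff2 _ _ _ i HB). fs.
        fbx e; assumption. }
      apply (Rel_intro _ _ _ _ _ _ _ Ht Hid Hv). fs.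
      fbx e; [exact He|]. fbx z; [exact Hz|]. fbx x; [exact Hx|]. fbx y; [exact Hy|].
      fsplit; assumption.
    + exact (PairIn_intro _ _ _ _ _ L3 Hy).
Qed.
End Derivations.

(** * Compactness *)

Definition SoundPair (s p v c k : nat) : fm :=
  OPair k v c && Sub v s && BAll c (InI (S p) (SetCls (S v)) 0).
(** All that is kept of the trees: m depends on S and Φ only, and refers to no particular u. *)
Definition Generic (s p m : nat) : fm :=
  BAll m (Ex (Ex (SoundPair (3 + s) (3 + p) 1 0 2))) &&
  All (Sub 0 (S s) --> All (InI (2 + p) (SetCls 1) 0 -->
    BEx (2 + m) (Ex (Ex (OPair 2 1 0 && Sub 1 4 && 3 ∈ 0))))).

Lemma ren_SoundPair f s p v c k :
  ren f (SoundPair s p v c k) = SoundPair (f s) (f p) (f v) (f c) (f k).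
Proof. reflexivity. Qed.
Lemma ren_Generic f s p m : ren f (Generic s p m) = Generic (f s) (f p) (f m).
Proof. reflexivity. Qed.
#[local] Hint Rewrite ren_SoundPair ren_Generic : fm.

Section Compactness.
Local Notation "G ⊢ A" := (prv CZF_WS_AMC G A) (at level 70).

Lemma Generic_ex G s p : G ⊢ IndDef s p -> G ⊢ Ex (Generic (S s) (S p) 0).
Proof.
  intros Hp. fxe (Cov_ex G s p Hp) q Hq.
  pose proof (Labels_ex G s q) as HL. fx HL a. fx HL b. fx HL f.
  pose proof HL as Hf. fa Hf F1 F2 F3 F4 F5. fxe (IsW_ex G f b a F1) W HW.
  pose proof (Value_total _ _ _ _ _ _ _ _ Hp HL HW) as K.
  apply collection_ex in K. fx K m. fa K K1 K2. fex m. apply AndI.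
  - fi k Hk. fbl K2 k Hk as L. fx L w Hw. fx L v. fx L c. fa L L1 L2 L3 L4.
    fex v. fex c. apply AndI; [apply AndI|]; assumption.
  - fi u. fi Hu. fi x. fi Hx.
    pose proof (Der_complete _ _ _ _ _ _ _ _ _ _ Hp HL HW Hq Hu Hx) as L. fx L w Hw.
    fbl K1 w Hw as M. fx M k Hk. fx M v. fx M c. fa M M1 M2 M3 M4.
    fal M4 u as N. fal N x as P. pose proof (ImpE _ _ _ _ (ImpE _ _ _ _ P Hu) L) as R.
    fa R R1 R2. fbx k; [exact Hk|]. fex v. fex c. fsplit; assumption.
Qed.

(** I(Φ,u) consists of the x ∈ S with x ∈ c and v ⊆ u for some (v, c) ∈ m, which is a bounded
    condition. *)
Lemma IndClass_set G s p u : G ⊢ IndDef s p -> G ⊢ Sub u s ->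
  G ⊢ Ex (All (0 ∈ 1 <--> InI (2 + p) (SetCls (2 + u)) 0)).
Proof.
  intros Hp Hu. fxe (Generic_ex G s p Hp) m Hm. fa Hm H1 H2.
  pose proof (separation_ex G s (BEx (S m) (BEx 0 (BEx 0 (BEx 1
    (OPair 3 1 0 && Sub 1 (5 + u) && 4 ∈ 0)))))) as K.
  lapply K; clear K; [intros K|delta0]. fx K j. fex j. fi x. fsplit; fi Hx.
  - pose proof (all_iff1 _ _ _ x K Hx) as L. fa L L1 L2. fs_in L2.
    fx L2 k Hk. fx L2 n Hn. fx L2 v Hv. fx L2 c Hc. fa L2 M1 M2 M3.
    fbl H1 k Hk as N. fx N v'. fx N c'. fa N N1 N2 N3.
    pose proof (OPair_inj _ _ _ _ _ _ N1 M1) as E. fa E E1 E2. fsubst E1. fsubst E2.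
    fbl N3 x M3 as P. exact (InI_mono _ _ _ _ _ M2 P).
  - apply (all_iff2 _ _ _ x K). fs. apply AndI.
    + apply (InI_sub _ _ _ _ _ Hp Hu Hx).
    + fal H2 u as L. pose proof (ImpE _ _ _ _ L Hu) as M. fal M x as N.
      pose proof (ImpE _ _ _ _ N Hx) as P. fx P k Hk. fx P v. fx P c. fa P P1 P2 P3.
      pose proof (OPair_bound _ _ _ _ P1) as B. fx B n Hn. fa B B1 B2.
      fbx k; [exact Hk|]. fbx n; [exact Hn|]. fbx v; [exact B1|]. fbx c; [exact B2|].
      fsplit; assumption.
Qed.

(** Only sets U are quantified here; classes U are reduced to sets by InI_set_sub. *)
Definition Compact (s p b : nat) : fm :=
  All (Sub 0 (S s) --> All (InI (2 + p) (SetCls 1) 0 -->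
    BEx (2 + b) (Sub 0 2 && InI (3 + p) (SetCls 0) 1))).

Lemma ren_Compact f s p b : ren f (Compact s p b) = Compact (f s) (f p) (f b).
Proof. reflexivity. Qed.
#[local] Hint Rewrite ren_Compact : fm.

Lemma Compact_ex G s p : G ⊢ IndDef s p ->
  G ⊢ Ex (BAll 0 (Sub 0 (2 + s)) && Compact (S s) (S p) 0).
Proof.
  intros Hp. fxe (Generic_ex G s p Hp) m Hm. fa Hm H1 H2.
  assert (K : G ⊢ BAll m (Ex (Ex (SoundPair (3 + s) (3 + p) 1 0 2)))) by exact H1.
  (* b collects the first components of the pairs in m; a pair determines its components, so the v
     found in b for k is that of k. *)
  apply collection_ex in K. fx K b. fa K K1 K2. fex b. apply AndI.
  - fi v Hv. fbl K2 v Hv as L. fx L k Hk. fx L c. fa L L1 L2 L3. exact L2.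
  - fi u. fi Hu. fi x. fi Hx. fal H2 u as L. pose proof (ImpE _ _ _ _ L Hu) as M.
    fal M x as N. pose proof (ImpE _ _ _ _ N Hx) as P. fx P k Hk. fx P v. fx P c.
    fa P P1 P2 P3. fbl K1 k Hk as R. fx R v' Hv'. fx R c'. fa R R1 R2 R3.
    pose proof (OPair_inj _ _ _ _ _ _ R1 P1) as E. fa E E1 E2. fsubst E1. fsubst E2.
    fbx v; [exact Hv'|]. fsplit; [exact P2|]. now fbl R3 x P3 as Q.
Qed.

Lemma Compact_class G s p b U a : G ⊢ Compact s p b -> G ⊢ SubCls U (SetCls s) ->
  G ⊢ InI p U a ->
  G ⊢ BEx b (SubCls (SetCls 0) (lift 1 1 U) && InI (S p) (SetCls 0) (S a)).
Proof.
  intros H HU Ha. apply InI_set_sub in Ha. rx Ha v. unfold SubCls in Ha. fs_in Ha.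
  fold_id U Ha. fa Ha Hv Ha. change (G ⊢ SubCls (SetCls v) U) in Hv.
  assert (Hs : G ⊢ Sub v s).
  { fi x Hx. apply (sub_at _ U (SetCls s) x HU). exact (sub_at _ (SetCls v) U x Hv Hx). }
  fal H v as K. pose proof (ImpE _ _ _ _ K Hs) as L. fal L a as M.
  pose proof (ImpE _ _ _ _ M Ha) as N. fx N w Hw. fa N N1 N2.
  apply bex_intro with w; [exact Hw|]. unfold SubCls. fs. apply AndI; [|exact N2].
  goal_id U. apply (SubCls_intro _ (SetCls w) U). intros x G' Hs' Hx. wk Hs'.
  apply (sub_at _ (SetCls v) U x Hv). exact (sub_elim _ _ _ _ N1 Hx).
Qed.

End Compactness.

Theorem theorem2p5 :
  exists I : nat -> nat -> fm -> fm,
    (forall (s p : nat) (U : fm), IsLeastClosed CZF s p U (I s p U)) /\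
    (forall s p : nat,
      (* (1): the bound variable 0 is the set U *)
      prv CZF_WS_AMC [IndDef s p]
        (All (Sub 0 (S s) --> IsSet (I (S s) (S p) (SetCls 0)))) /\
      (* (2): B is variable 0 of the second context; in the last formula
         a is bound by All and V by the BEx *)
      (exists X : fm,
        prv CZF_WS_AMC [IndDef s p] (Ex (BAll 0 (Sub 0 (2 + s)) && X)) /\
        (forall U : fm,
          prv CZF_WS_AMC
            [X; BAll 0 (Sub 0 (2 + s)); IndDef (S s) (S p);
             SubCls U (SetCls (S s))]
            (All (I (S s) (S p) U -->
               BEx 1 (SubCls (SetCls 0) (lift 1 2 U) &&
                      inst 1 (I (3 + s) (3 + p) (SetCls 0)))))))).
Proof.
  exists IndClass. split; [intros; apply IndClass_least|]. intros s p. split.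
  - assert (Hp : prv CZF_WS_AMC [IndDef s p] (IndDef s p)) by (apply Hyp; now left).
    apply all_intro. intros u. apply imp_intro. intros G Hs Hu. wk Hs.
    exact (IndClass_set G s p u Hp Hu).
  (* [X] must be a single formula about B that yields (2) for every class U separately; compactness
     for sets can quantify over u internally. *)
  - exists (Compact (S s) (S p) 0). split.
    + apply Compact_ex, Hyp. now left.
    + intros U. set (G := [_; _; _; _]).
      assert (HC : prv CZF_WS_AMC G (Compact (S s) (S p) 0)) by (apply Hyp; now left).
      assert (HU : prv CZF_WS_AMC G (SubCls U (SetCls (S s)))) by (apply Hyp; do 3 right; now left).
      clearbody G. apply all_intro. intros a. apply imp_intro. intros G' Hs Ha. wk Hs.
      change (prv CZF_WS_AMC G (at1 (IndClass (S s) (S p) U) a)) in Ha. rewrite at1_IndClass in Ha.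
      pose proof (Compact_class _ _ _ _ _ _ HC HU Ha) as K.
      rx K v Hv. apply bex_intro with v; [exact Hv|].
      unfold SubCls in *. fs_in K. fs. fold_id U K. goal_id U. exact K.
Qed.
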